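(* Let $X_1,\dots,X_n$ be iid random variables in a separable and measurable space $(S,\mathcal{S})$. Let $f:S\times S\to\mathbb{R}^d$ be an $\mathcal{S}\otimes\mathcal{S}$-measurable, symmetric and canonical kernel such that $\mathbb{E}|f_m(X_1,X_2)|<\infty$ for all $m=1,\dots,d$. Let $$V_n=\frac1{n(n-1)}\sum_{1\le i\ne j\le n}f(X_i,X_j),\quad M=\max_{1\le i\ne j\le n}\max_{1\le m\le d}|f_m(X_i,X_j)|,\quad D_q=\max_{1\le m\le d}(\mathbb{E}|f_m(X_1,X_2)|^q)^{1/q}\ (q>0).$$ If $2\le d\le\exp(bn)$ for some constant $b>0$, then there exists an absolute constant $K>0$ such that $$\mathbb{E}[|V_n|_\infty]\le K(1+b^{1/2})\left\{\left(\frac{\log d}{n}\right)^{3/2}\|M\|_4+\frac{\log d}{n}D_2+\left(\frac{\log d}{n}\right)^{5/4}D_4\right\}.$$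
   Context: $n\ge4$. $f$ is symmetric if $f(x_1,x_2)=f(x_2,x_1)$, and canonical (completely degenerate) if $\mathbb{E}[f(x_1,X_2)]=\mathbb{E}[f(X_1,x_2)]=\mathbb{E}[f(X_1,X_2)]=0$ for all $x_1,x_2\in S$. $|v|_\infty=\max_j|v_j|$ and $\|\xi\|_q=(\mathbb{E}|\xi|^q)^{1/q}$. ''Absolute constant'' means not depending on $n,d,b,f$ or the distribution of $X_1$. *)

(* Defs.v *)
From HB Require Import structures.
From mathcomp Require Import all_boot all_order all_algebra.
From mathcomp Require Import all_classical all_reals all_analysis.

Set Implicit Arguments.
Unset Strict Implicit.
Unset Printing Implicit Defensive.

Import Order.TTheory GRing.Theory Num.Theory.
Import numFieldNormedType.Exports.

Local Open Scope classical_set_scope.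
Local Open Scope ring_scope.

(* A measurable space is separable when its sigma-algebra is countably
   generated; for the Borel sets of a separable metric space this holds. *)
Definition separable_measurable (dS : measure_display)
    (S : measurableType dS) : Prop :=
  exists G : nat -> set S, @measurable dS S = <<s range G >>.

Definition mutually_independent (R : realType) (dW dS : measure_display)
    (W : measurableType dW) (S : measurableType dS) (P : probability W R)
    (n : nat) (X : 'I_n -> {RV P >-> S}) : Prop :=
  forall (J : {set 'I_n}) (A : 'I_n -> set S),
    (forall i, i \in J -> measurable (A i)) ->
    P (\bigcap_(i in [set` J]) (X i @^-1` A i)) =
    (\prod_(i in J) P (X i @^-1` A i))%E.

Definition identically_distributed (R : realType) (dW dS : measure_display)
    (W : measurableType dW) (S : measurableType dS) (P : probability W R)
    (n : nat) (X : 'I_n -> {RV P >-> S}) : Prop :=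
  forall (i j : 'I_n) (A : set S), measurable A ->
    distribution P (X i) A = distribution P (X j) A.

Definition iid (R : realType) (dW dS : measure_display)
    (W : measurableType dW) (S : measurableType dS) (P : probability W R)
    (n : nat) (X : 'I_n -> {RV P >-> S}) : Prop :=
  mutually_independent X /\ identically_distributed X.

(* A kernel S x S -> R^d takes values in row vectors, [f x y ord0 m] being the
   coordinate f_m(x, y).  R^d carries its product (Borel) sigma-algebra, so that
   measurability is coordinatewise. *)
Definition kernel_measurable (R : realType) (dS : measure_display)
    (S : measurableType dS) (d : nat) (f : S -> S -> 'rV[R]_d) : Prop :=
  forall m : 'I_d,
    measurable_fun [set: S * S] (fun z : S * S => f z.1 z.2 ord0 m).

Definition kernel_symmetric (R : realType) (dS : measure_display)
    (S : measurableType dS) (d : nat) (f : S -> S -> 'rV[R]_d) : Prop :=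
  forall x1 x2 : S, f x1 x2 = f x2 x1.

(* The expectation ['E_P[_]] is extended-real valued and equals -oo when both
   the positive and the negative part have infinite integral; hence each
   equation below includes the integrability of the function concerned. *)
Definition kernel_canonical (R : realType) (dW dS : measure_display)
    (W : measurableType dW) (S : measurableType dS) (P : probability W R)
    (X1 X2 : {RV P >-> S}) (d : nat) (f : S -> S -> 'rV[R]_d) : Prop :=
  forall m : 'I_d,
    [/\ forall x1 : S, ('E_P[fun w => f x1 (X2 w) ord0 m] = 0)%E,
        forall x2 : S, ('E_P[fun w => f (X1 w) x2 ord0 m] = 0)%E
      & ('E_P[fun w => f (X1 w) (X2 w) ord0 m] = 0)%E].

Definition Vn (R : realType) (dW dS : measure_display)
    (W : measurableType dW) (S : measurableType dS) (P : probability W R)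
    (n : nat) (X : 'I_n -> {RV P >-> S}) (d : nat) (f : S -> S -> 'rV[R]_d)
    (w : W) : 'rV[R]_d :=
  (n%:R * (n%:R - 1))^-1 *:
    \sum_(i < n) \sum_(j < n | i != j) f (X i w) (X j w).

Definition Mn (R : realType) (dW dS : measure_display)
    (W : measurableType dW) (S : measurableType dS) (P : probability W R)
    (n : nat) (X : 'I_n -> {RV P >-> S}) (d : nat) (f : S -> S -> 'rV[R]_d)
    (w : W) : R :=
  \big[Num.max/0]_(i < n) \big[Num.max/0]_(j < n | i != j)
    \big[Num.max/0]_(m < d) `|f (X i w) (X j w) ord0 m|.

(* ['N[P]_q%:E[g]] is (E |g|^q)^(1/q), possibly +oo. *)
Definition Dq (R : realType) (dW dS : measure_display)
    (W : measurableType dW) (S : measurableType dS) (P : probability W R)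
    (X1 X2 : {RV P >-> S}) (d : nat) (f : S -> S -> 'rV[R]_d)
    (q : R) : \bar R :=
  (\big[maxe/0]_(m < d)
    'N[P]_(q%:E)[EFin \o (fun w => f (X1 w) (X2 w) ord0 m)])%E.

Definition first_index (n : nat) (n4 : (4 <= n)%N) : 'I_n :=
  Ordinal (leq_trans (isT : (0 < 4)%N) n4).

Definition second_index (n : nat) (n4 : (4 <= n)%N) : 'I_n :=
  Ordinal (leq_trans (isT : (1 < 4)%N) n4).

(* Main.v *)
(* Replacing the coordinates one at a time, convexity of the sup norm gives
   E |sum_{i<>j} h(X_i, X_j)| <= E |sum_{i<>j} (E_i + 2 e_i)(E_j + 2 e_j) h(X_i, X_j)|
   for every symmetric kernel h, where E_i is the expectation in the i-th
   variable and the e_i are independent random signs.  No decoupling of the X_i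
   is needed.  Given the X_i, the signs form a Rademacher chaos, whose maximum
   over d coordinates is at most a constant times log d times the largest
   Euclidean norm of the coefficients.

   For h = f, canonical, only the chaos remains, and E |V_n| is bounded through
   I = E max_m sum_{i<>j} f_m(X_i, X_j)^2.  For h = min(f^2, N) the same
   inequality splits I into a mean (D_2), a linear part in
   g_m(x) = E h_m(x, X), and a chaos of Euclidean norm at most M sqrt(I), so that
   I can be absorbed on the left.  The linear part is treated likewise with g^2
   (D_4); there max_i g_m(X_i)^2 is controlled by E M^4 because g_m(X_i) is a
   conditional expectation given all but one of the other variables.  The
   truncation level N then tends to infinity. *)
Require Import Defs.
From HB Require Import structures.
From mathcomp Require Import all_boot all_order all_algebra.
From mathcomp Require Import all_classical all_reals all_analysis.
From mathcomp Require Import measurable_realfun.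
From mathcomp Require Import ring lra.

Set Implicit Arguments.
Unset Strict Implicit.
Unset Printing Implicit Defensive.

Import Order.TTheory GRing.Theory Num.Theory.
Import numFieldNormedType.Exports.

Local Open Scope classical_set_scope.
Local Open Scope ring_scope.

(** * Sign averages and Rademacher chaos *)

(** Signs are finite averages over [{ffun 'I_n -> bool}] taken at a fixed sample, so no second
    probability space is built; the law of the sample enters only through replacing one coordinate
    by a fresh draw. I is bounded by absorption, from an inequality I <= A + I/2. This says nothing
    when I is infinite, which is why the squares are truncated and why A must not depend on the
    truncation level. The sum of the g_m(X_i)^2 is bounded by the same device. The logarithm comes
    from exponential moments: a suitably normalised squared norm satisfies E exp <= 2 in each
    coordinate, so its maximum over d coordinates has mean at most log (2 d). With r = log d / n,
    the norm of M receives the factors r^(3/2) and r^2. The second comes from the term (log d)^2 M^2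
    that pays for absorbing the chaos. The growth condition gives r <= b, hence r^2 <= b^(1/2)
    r^(3/2): this is the origin of 1 + b^(1/2). *)

Section SupNorm.
Context (R : realType) (d : nat).
Implicit Types (v : 'I_d -> R).

Definition nrm v : R := \big[Num.max/0]_(m < d) `|v m|.

Lemma nrm_ge0 v : 0 <= nrm v.
Proof. exact: bigmax_ge_id. Qed.

Lemma le_nrm v m : `|v m| <= nrm v.
Proof. exact: le_bigmax. Qed.

Lemma nrm_le v c : 0 <= c -> (forall m, `|v m| <= c) -> nrm v <= c.
Proof. by move=> c0 vc; apply: bigmax_le. Qed.

Lemma nrmD v1 v2 : nrm (fun m => v1 m + v2 m) <= nrm v1 + nrm v2.
Proof.
apply: nrm_le => [|m]; first by rewrite addr_ge0 ?nrm_ge0.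
by rewrite (le_trans (ler_normD _ _))// lerD ?le_nrm.
Qed.

Lemma nrmZ c v : nrm (fun m => c * v m) = `|c| * nrm v.
Proof.
apply/le_anti/andP; split.
  apply: nrm_le => [|m]; first by rewrite mulr_ge0 ?nrm_ge0.
  by rewrite normrM ler_wpM2l ?le_nrm.
have [->|c0] := eqVneq c 0; first by rewrite normr0 mul0r nrm_ge0.
rewrite mulrC -ler_pdivlMr ?normr_gt0//.
apply: nrm_le => [|m]; first by rewrite divr_ge0 ?nrm_ge0.
rewrite ler_pdivlMr ?normr_gt0// mulrC -normrM.
exact: (le_nrm (fun m => c * v m)).
Qed.

Lemma le_nrm2 v1 v2 : (forall m, `|v1 m| <= `|v2 m|) -> nrm v1 <= nrm v2.
Proof.
move=> v12; apply: nrm_le => [|m]; first exact: nrm_ge0.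
exact: le_trans (v12 m) (le_nrm _ _).
Qed.

End SupNorm.

Section Rademacher.
Context (R : realType) (n : nat).
Local Notation signs := {ffun 'I_n -> bool}.
Implicit Types (e : signs) (i : 'I_n).

Definition sg e i : R := (-1) ^+ e i.

Definition avg (phi : signs -> R) : R := (2 ^+ n)^-1 * \sum_e phi e.

Definition flip i e : signs := [ffun j => e j (+) (j == i)].

Lemma flipK i : involutive (flip i).
Proof. by move=> e; apply/ffunP => j; rewrite !ffunE -addbA addbb addbF. Qed.

Lemma sgM e i : sg e i * sg e i = 1.
Proof. by rewrite /sg -expr2 sqrr_sign. Qed.

Lemma sg_flip i e j : sg (flip i e) j = if j == i then - sg e j else sg e j.
Proof.
rewrite /sg ffunE; case: (j == i); rewrite ?addbF// addbT.
by case: (e j); rewrite /= ?expr0 ?expr1 ?opprK.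
Qed.

Lemma avg_bij (h : signs -> signs) phi :
  bijective h -> avg phi = avg (phi \o h).
Proof.
by move=> bh; rewrite /avg (reindex h)//; exact: onW_bij.
Qed.

(** Integrates out the [i]-th sign alone, since [flip i] permutes the sign vectors. Both inductions
    over coordinates below treat one sign at a time in this form. *)
Lemma avg_flip i phi : avg phi = avg (fun e => 2^-1 * (phi e + phi (flip i e))).
Proof.
rewrite /avg -mulr_sumr big_split/=.
have <- : \sum_e phi e = \sum_e phi (flip i e).
  by rewrite (reindex (flip i))//; apply: onW_bij; exists (flip i); exact: flipK.
by congr (_ * _); field.
Qed.

Lemma le_avg phi psi : (forall e, phi e <= psi e) -> avg phi <= avg psi.
Proof.
move=> pp; rewrite /avg ler_pM2l ?invr_gt0 ?exprn_gt0//.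
by apply: ler_sum.
Qed.

Lemma avg_ge0 phi : (forall e, 0 <= phi e) -> 0 <= avg phi.
Proof.
by move=> p0; rewrite /avg mulr_ge0 ?invr_ge0 ?exprn_ge0// sumr_ge0.
Qed.

Lemma avg_cst c : avg (fun=> c) = c.
Proof.
rewrite /avg sumr_const card_ffun card_bool card_ord -[c *+ _]mulr_natl natrX.
by rewrite mulrA mulVf ?mul1r// expf_neq0// pnatr_eq0.
Qed.

Lemma avgD phi psi : avg (fun e => phi e + psi e) = avg phi + avg psi.
Proof. by rewrite /avg big_split/= mulrDr. Qed.

Lemma avgZ c phi : avg (fun e => c * phi e) = c * avg phi.
Proof. by rewrite /avg -mulr_sumr mulrCA. Qed.

Lemma avg_sum (I : finType) (P : pred I) (phi : I -> signs -> R) :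
  avg (fun e => \sum_(i | P i) phi i e) = \sum_(i | P i) avg (phi i).
Proof. by rewrite /avg exchange_big mulr_sumr. Qed.

Lemma avg_exchange (phi : signs -> signs -> R) :
  avg (fun e => avg (phi e)) = avg (fun e' => avg (phi ^~ e')).
Proof. by rewrite /avg -!mulr_sumr exchange_big. Qed.

Lemma avg_sqr phi : avg phi ^+ 2 <= avg (fun e => phi e ^+ 2).
Proof.
have : 0 <= avg (fun e => (phi e - avg phi) ^+ 2).
  by apply: avg_ge0 => e; exact: sqr_ge0.
rewrite (_ : (fun _ => _) = fun e => phi e ^+ 2 +
    ((- 2 * avg phi) * phi e + avg phi ^+ 2)); last by apply/funext => e; ring.
by rewrite avgD avgD avgZ avg_cst; lra.
Qed.

Lemma avg_le_sqrt phi B : avg (fun e => phi e ^+ 2) <= B -> avg phi <= Num.sqrt B.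
Proof.
move=> B_; apply: le_trans (ler_norm _) _; rewrite -sqrtr_sqr ler_wsqrtr//.
exact: le_trans (avg_sqr _) B_.
Qed.

Lemma avg_sg i : avg (fun e => sg e i) = 0.
Proof.
rewrite (avg_flip i) (_ : (fun _ => _) = fun=> 0) ?avg_cst//.
by apply/funext => e; rewrite sg_flip eqxx subrr mulr0.
Qed.

Lemma avg_sg2 i j : i != j -> avg (fun e => sg e i * sg e j) = 0.
Proof.
move=> ij; rewrite (avg_flip i) (_ : (fun _ => _) = fun=> 0) ?avg_cst//.
apply/funext => e; rewrite !sg_flip eqxx eq_sym (negbTE ij).
by rewrite mulNr subrr mulr0.
Qed.

End Rademacher.
Arguments sg {R n}.
Arguments avg {R n}.

(** * Exponential moments of squared norms of Rademacher sums *)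

Section SubGaussian.
Context (R : realType).

(* For [t^2 <= 1/2], [cosh t <= 1/(1 - t^2)] by [1 + x <= exp x], and
   [exp (- 2 s) <= 1/(1 + 2 s) <= 1 - s] for [0 <= s <= 1/2]. *)
Lemma cosh_le (t : R) : expR t + expR (- t) <= 2 * expR (2 * t ^+ 2).
Proof.
have [t2|t2] := leP (t ^+ 2) (2^-1); last first.
  have t1 : `|t| <= 2 * t ^+ 2.
    by rewrite -real_normK ?num_real//; have := normr_ge0 t; 
    rewrite -real_normK ?num_real// in t2; nra.
  have h1 : expR t <= expR (2 * t ^+ 2) by rewrite ler_expR (le_trans _ t1)// ler_norm.
  have h2 : expR (- t) <= expR (2 * t ^+ 2).
    by rewrite ler_expR (le_trans _ t1)// -normrN ler_norm.
  lra.
set s := t ^+ 2 in t2 *.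
have s0 : 0 <= s by exact: sqr_ge0.
have tlt1 : `|t| < 1.
  rewrite ltNge; apply/negP => t1.
  have : 1 <= s by rewrite /s -real_normK ?num_real// expr_ge1 //.
  lra.
have [tl tr] : -1 < t /\ t < 1 by move: tlt1; rewrite ltr_norml => /andP[].
have inv_le (x y : R) : 0 < y -> y <= expR (- x) -> expR x <= y^-1.
  move=> y0 yx; rewrite -[x]opprK expRN lef_pV2 ?posrE ?expR_gt0//.
have h1 : expR t <= (1 - t)^-1 by apply: inv_le; [lra|have := expR_ge1Dx (- t); lra].
have h2 : expR (- t) <= (1 + t)^-1.
  by apply: inv_le; [lra|have := expR_ge1Dx t; rewrite opprK; lra].
have h3 : (1 - s)^-1 <= expR (2 * s).
  rewrite -[expR _]invrK -expRN lef_pV2 ?posrE ?expR_gt0//; last lra.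
  have e0 : expR (- (2 * s)) <= (1 + 2 * s)^-1.
    by apply: inv_le; [lra|have := expR_ge1Dx (2 * s); rewrite opprK; lra].
  apply: le_trans e0 _; rewrite -div1r ler_pdivrMr; nra.
have h4 : (1 - t)^-1 + (1 + t)^-1 = 2 * (1 - s)^-1.
  by rewrite /s; field; apply/and3P; split; apply/eqP; rewrite ?subr_sqr_1; nra.
lra.
Qed.

Context (n : nat) (J : finType).
Implicit Types (a : 'I_n -> J -> R).

Let sqn (v : J -> R) : R := \sum_j v j ^+ 2.

Lemma sqn_ge0 v : 0 <= sqn v.
Proof. by apply: sumr_ge0 => j _; exact: sqr_ge0. Qed.

Lemma sum_CS (v w : J -> R) : (\sum_j v j * w j) ^+ 2 <= sqn v * sqn w.
Proof.
set p := \sum_j v j * w j.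
have pol (t : R) : 0 <= sqn v + 2 * t * p + t ^+ 2 * sqn w.
  rewrite (_ : _ + _ = sqn (fun j => v j + t * w j)) ?sqn_ge0//.
  rewrite /sqn /p !mulr_sumr -!big_split/=; apply: eq_bigr => j _; ring.
have [w0|w0] := eqVneq (sqn w) 0.
  have wj j : w j = 0.
    apply/eqP; rewrite -sqrf_eq0; apply/eqP.
    by move: j isT; apply/psumr_eq0P => // j _; exact: sqr_ge0.
  rewrite w0 mulr0 /p big1 ?expr0n// => j _.
  by rewrite wj mulr0.
have wp : 0 < sqn w by rewrite lt_def w0 sqn_ge0.
have := pol (- p / sqn w).
rewrite (_ : _ + _ = sqn v - p ^+ 2 / sqn w); last by field.
by rewrite subr_ge0 ler_pdivrMr.
Qed.

(** The two squared norms are |x|^2 + |v|^2 +- 2p with p = <x, v>, so the average is an exponential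
    times cosh (2p/u) <= exp (8 p^2/u^2). Since p^2 <= |x|^2 s with s = |v|^2, this is paid for by
    lowering [u] to u - 8s, because (u + 8s)/u^2 <= 1/(u - 8s). *)
Lemma expR_sign_step (x v : J -> R) (u : R) : 8 * sqn v < u ->
  2^-1 * (expR (sqn (fun j => x j + v j) / u) + expR (sqn (fun j => x j - v j) / u))
  <= expR (sqn v / u) * expR (sqn x / (u - 8 * sqn v)).
Proof.
move=> vu; have v0 := sqn_ge0 v; have x0 := sqn_ge0 x.
have u0 : 0 < u by lra.
set p := \sum_j x j * v j.
have e1 : sqn (fun j => x j + v j) / u = (sqn x + sqn v) / u + 2 * p / u.
  rewrite -mulrDl /sqn /p mulr_sumr -!big_split/=; congr (_ / _).
  by apply: eq_bigr => j _; ring.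
have e2 : sqn (fun j => x j - v j) / u = (sqn x + sqn v) / u - 2 * p / u.
  rewrite -mulrBl /sqn /p mulr_sumr -!big_split/= -sumrB; congr (_ / _).
  by apply: eq_bigr => j _; ring.
rewrite e1 e2 !expRD -mulrDr mulrCA.
have := cosh_le (2 * p / u); set E1 := expR (2 * _ / _); set E2 := expR (- _).
move=> ch.
apply: (@le_trans _ _ (expR ((sqn x + sqn v) / u) * expR (2 * (2 * p / u) ^+ 2))).
  by rewrite ler_wpM2l ?expR_ge0//; lra.
rewrite -!expRD ler_expR.
have -> : (sqn x + sqn v) / u + 2 * (2 * p / u) ^+ 2 =
  sqn v / u + (sqn x / u + 8 * p ^+ 2 / u ^+ 2) by field; lra.
rewrite lerD2l.
apply: (@le_trans _ _ (sqn x * (u + 8 * sqn v) / u ^+ 2)).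
  rewrite (_ : sqn x * _ / _ = sqn x / u + 8 * (sqn x * sqn v) / u ^+ 2); last by field; lra.
  by rewrite lerD2l ler_pM2r ?invr_gt0 ?exprn_gt0// ler_pM2l// sum_CS.
rewrite -mulrA ler_wpM2l// ler_pdivrMr ?exprn_gt0//.
rewrite [leRHS]mulrC ler_pdivlMr; last lra.
nra.
Qed.

(** Each sign uses up [8 * sqn (a i)] of the parameter [u], so all of them can be averaged out as
    long as [u] exceeds the total. *)
Lemma avg_expR_sqn a u : 8 * (\sum_i sqn (a i)) < u ->
  avg (fun e => expR (sqn (fun j => \sum_i sg e i * a i j) / u)) <=
  expR ((\sum_i sqn (a i)) / (u - 8 * \sum_i sqn (a i))).
Proof.
pose S k (e : {ffun 'I_n -> bool}) j := \sum_(i < n | (i < k)%N) sg e i * a i j.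
pose A k := \sum_(i < n | (i < k)%N) sqn (a i).
(* The parameter stays general because the induction hypothesis is applied at
   [u - 8 * sqn (a i0)]. *)
suff H k : (k <= n)%N -> forall u, 8 * A k < u ->
    avg (fun e => expR (sqn (S k e) / u)) <= expR (A k / (u - 8 * A k)).
  have An : A n = \sum_i sqn (a i) by apply: eq_bigl => i; rewrite ltn_ord.
  have Sn : S n = fun e j => \sum_i sg e i * a i j.
    by apply/funext => e; apply/funext => j; apply: eq_bigl => i; rewrite ltn_ord.
  by rewrite -An => /(H n (leqnn n)); rewrite Sn.
elim: k => [_ {}u|k IH kn {}u].
  rewrite /A big_pred0 // mul0r => u0; rewrite expR0.
  rewrite (_ : (fun _ => _) = fun=> 1) ?avg_cst//; apply/funext => e.
  rewrite /S /sqn big1 ?mul0r ?expR0// => j _.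
  by rewrite big_pred0// expr0n.
pose i0 := Ordinal kn.
have AS : A k.+1 = A k + sqn (a i0).
  rewrite /A (bigD1 i0) ?ltnSn//= addrC; congr (_ + _); apply: eq_bigl => i.
  by rewrite ltnS ltn_neqAle andbC -val_eqE.
have SS e j : S k.+1 e j = S k e j + sg e i0 * a i0 j.
  rewrite /S (bigD1 i0) ?ltnSn//= addrC; congr (_ + _); apply: eq_bigl => i.
  by rewrite ltnS ltn_neqAle andbC -val_eqE.
have Sf e j : S k (flip i0 e) j = S k e j.
  apply: eq_bigr => i ik; rewrite sg_flip; case: eqVneq => // ii.
  by rewrite ii ltnn in ik.
rewrite AS => Au; have A0 : 0 <= A k by apply: sumr_ge0 => i _; exact: sqn_ge0.
have s0 := sqn_ge0 (a i0).
have IHu := IH (ltnW kn) (u - 8 * sqn (a i0)) ltac:(lra).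
rewrite (avg_flip i0).
apply: (@le_trans _ _ (avg (fun e => expR (sqn (a i0) / u) *
    expR (sqn (S k e) / (u - 8 * sqn (a i0)))))).
  apply: le_avg => e.
  have st := @expR_sign_step (S k e) (a i0) u ltac:(lra).
  apply: le_trans st; rewrite ler_pM2l ?invr_gt0// le_eqVlt; apply/orP; left; apply/eqP.
  have -> : S k.+1 e = fun j => S k e j + sg e i0 * a i0 j by apply/funext => j; rewrite SS.
  have -> : S k.+1 (flip i0 e) = fun j => S k e j - sg e i0 * a i0 j.
    by apply/funext => j; rewrite SS Sf sg_flip eqxx mulNr.
  have aN : (fun j => S k e j + -1 * a i0 j) = (fun j => S k e j - a i0 j).
    by apply/funext => j; rewrite mulN1r.
  have aN' : (fun j => S k e j - -1 * a i0 j) = (fun j => S k e j + a i0 j).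
    by apply/funext => j; rewrite mulN1r opprK.
  have a1 : (fun j => S k e j + 1 * a i0 j) = (fun j => S k e j + a i0 j).
    by apply/funext => j; rewrite mul1r.
  have a1' : (fun j => S k e j - 1 * a i0 j) = (fun j => S k e j - a i0 j).
    by apply/funext => j; rewrite mul1r.
  rewrite /sg; case: (e i0) => /=; rewrite ?expr0 ?expr1 ?aN ?aN' ?a1 ?a1' //.
  exact: addrC.
rewrite avgZ; apply: (le_trans (ler_wpM2l (expR_ge0 _) IHu)).
rewrite -expRD ler_expR (_ : u - _ - _ = u - 8 * (A k + sqn (a i0))); last by ring.
rewrite [leRHS]mulrDl addrC lerD2l ler_wpM2l// lef_pV2 ?posrE; lra.
Qed.

End SubGaussian.

(** * Maxima of linear forms and of chaoses in random signs *)

Section RademacherMaxima.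
Context (R : realType) (n d : nat).
Hypothesis d0 : (0 < d)%N.
Local Notation signs := {ffun 'I_n -> bool}.
Local Notation L := (ln (2 * d%:R) : R).

Lemma ln2d_gt0 : 0 < L.
Proof.
have d1 : 1 <= d%:R :> R by rewrite ler1n.
by apply: ln_gt0; lra.
Qed.

(* Jensen's inequality for [exp], through the tangent bound
   [x <= L - 1 + exp x / exp L]. *)
Lemma avg_max_le (Y : signs -> 'I_d -> R) :
  (forall e m, 0 <= Y e m) -> (forall m, avg (fun e => expR (Y e m)) <= 2) ->
  avg (fun e => nrm (Y e)) <= L.
Proof.
move=> Y0 Y2; have d1 : 1 <= d%:R :> R by rewrite ler1n.
have d2 : 0 < 2 * d%:R :> R by lra.
apply: (@le_trans _ _ (avg (fun e => (L - 1) +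
    (2 * d%:R)^-1 * \sum_(m < d) expR (Y e m)))).
  apply: le_avg => e.
  have h := expR_ge1Dx (nrm (Y e) - L).
  apply: (@le_trans _ _ (L - 1 + expR (nrm (Y e) - L))); first by lra.
  rewrite lerD2l expRD expRN lnK ?posrE// mulrC ler_pM2l ?invr_gt0//.
  rewrite /nrm; have [m _ ->] := @Order.TotalTheory.eq_bigmax _ _ _ (0 : R) (Ordinal d0) xpredT
    (fun m => `|Y e m|) isT (fun m _ => normr_ge0 _).
  rewrite ger0_norm// (bigD1 m)//= lerDl sumr_ge0//.
rewrite avgD avgZ avg_cst avg_sum.
have : \sum_(m < d) avg (fun e => expR (Y e m)) <= 2 * d%:R.
  apply: (@le_trans _ _ (\sum_(m < d) 2)); first exact: ler_sum.
  by rewrite sumr_const card_ord -[2 *+ _]mulr_natr.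
by rewrite -(ler_pM2l (_ : 0 < (2 * d%:R)^-1)) ?invr_gt0// mulVf ?gt_eqF//; lra.
Qed.

(** At [u = 16 * A] the exponent in [avg_expR_sqn] is at most 1/2, so the exponential moment is at
    most 2, as [avg_max_le] requires; undoing the normalisation gives the factor 16. The case A = 0,
    where one cannot normalise, is separate. *)
Lemma avg_nrm_sqr_le (J : finType) (a : 'I_d -> 'I_n -> J -> R) A :
  0 <= A -> (forall m, \sum_i \sum_j a m i j ^+ 2 <= A) ->
  avg (fun e => nrm (fun m => \sum_j (\sum_i sg e i * a m i j) ^+ 2)) <= 16 * L * A.
Proof.
move=> A0 aA; have [A_eq0|A_neq0] := eqVneq A 0.
  have a0 m i j : a m i j = 0.
    apply/eqP; rewrite -sqrf_eq0; apply/eqP.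
    have /psumr_eq0P s0 : \sum_i \sum_j a m i j ^+ 2 = 0.
      apply/le_anti; rewrite (le_trans (aA m)) ?A_eq0//=.
      by apply: sumr_ge0 => ? _; apply: sumr_ge0 => ? _; exact: sqr_ge0.
    have /psumr_eq0P -> // := s0 (fun i _ => sumr_ge0 _ (fun j _ => sqr_ge0 _)) i isT.
    by move=> ? _; exact: sqr_ge0.
  rewrite A_eq0 mulr0 (_ : (fun _ => _) = fun=> 0) ?avg_cst//; apply/funext => e.
  apply/le_anti; rewrite nrm_ge0 andbT; apply: nrm_le => // m.
  rewrite big1 ?normr0// => j _; rewrite big1 ?expr0n// => i _.
  by rewrite a0 mulr0.
have A_gt0 : 0 < A by rewrite lt_def A_neq0.
pose Y e m := (\sum_j (\sum_i sg e i * a m i j) ^+ 2) / (16 * A).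
have Y0 e m : 0 <= Y e m.
  by rewrite divr_ge0 ?mulr_ge0// sumr_ge0// => j _; exact: sqr_ge0.
have Y2 m : avg (fun e => expR (Y e m)) <= 2.
  have B0 : 0 <= \sum_i \sum_j a m i j ^+ 2.
    by apply: sumr_ge0 => i _; apply: sumr_ge0 => j _; exact: sqr_ge0.
  have AB := aA m.
  have := @avg_expR_sqn R n J (a m) (16 * A) ltac:(lra).
  move/le_trans; apply.
  set B := \sum_i _ in B0 AB *.
  have h : B / (16 * A - 8 * B) <= 2^-1 by rewrite ler_pdivrMr; lra.
  rewrite -[expR _]invrK -expRN -[leRHS]invrK lef_pV2 ?posrE ?expR_gt0 ?invr_gt0//.
  have := expR_ge1Dx (- (B / (16 * A - 8 * B))); lra.
have := avg_max_le Y0 Y2; rewrite -(ler_pM2l (_ : 0 < 16 * A)) ?mulr_gt0//.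
rewrite -avgZ mulrAC; congr (avg _ <= _); apply/funext => e.
rewrite -[X in X * _](ger0_norm (_ : 0 <= 16 * A)) ?mulr_ge0// -nrmZ.
by congr nrm; apply/funext => m; rewrite /Y mulrC divfK// gt_eqF ?mulr_gt0.
Qed.

Lemma nrm_sqr (v : 'I_d -> R) : nrm v ^+ 2 <= nrm (fun m => v m ^+ 2).
Proof.
rewrite -[leRHS]sqr_sqrtr ?nrm_ge0//.
rewrite ler_pXn2r ?nnegrE ?nrm_ge0 ?sqrtr_ge0//.
apply: nrm_le => [|m]; first exact: sqrtr_ge0.
rewrite -sqrtr_sqr ler_wsqrtr//; apply: le_trans (le_nrm _ m).
exact: ler_norm.
Qed.

Lemma avg_nrm_le (c : 'I_d -> 'I_n -> R) A :
  0 <= A -> (forall m, \sum_i c m i ^+ 2 <= A) ->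
  avg (fun e => nrm (fun m => \sum_i sg e i * c m i)) <= Num.sqrt (16 * L * A).
Proof.
move=> A0 cA; apply: avg_le_sqrt.
apply: (@le_trans _ _ (avg (fun e =>
    nrm (fun m => \sum_(j < 1) (\sum_i sg e i * c m i) ^+ 2)))).
  apply: le_avg => e; apply: le_trans (nrm_sqr _) _.
  by under [X in _ <= nrm X]eq_fun do rewrite big_ord1.
apply: (@avg_nrm_sqr_le 'I_1 (fun m i _ => c m i)) => // m.
by under eq_bigr do rewrite big_ord1.
Qed.

Lemma nrm_avg (v : signs -> 'I_d -> R) :
  nrm (fun m => avg (v ^~ m)) <= avg (fun e => nrm (v e)).
Proof.
apply: nrm_le => [|m]; first by apply: avg_ge0 => e; exact: nrm_ge0.
rewrite /avg normrM ger0_norm ?invr_ge0 ?exprn_ge0//.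
rewrite ler_pM2l ?invr_gt0 ?exprn_gt0//.
apply: le_trans (ler_norm_sum _ _ _) _; apply: ler_sum => e _; exact: le_nrm.
Qed.

(** Multiplies by [sig] only the signs in the block [del]. For fixed [del] and [sig] this permutes
    the sign vectors, so [sig] can be averaged as a second, independent family of signs. *)
Let twist (del sig e : signs) : signs := [ffun i => e i (+) (del i && sig i)].

Lemma twistK del sig : involutive (twist del sig).
Proof. by move=> e; apply/ffunP => j; rewrite !ffunE -addbA addbb addbF. Qed.

Lemma sg_twist del sig e i :
  sg (twist del sig e) i = (if del i then sg sig i else 1) * sg e i :> R.
Proof.
rewrite /sg ffunE signr_addb mulrC; congr (_ * _).
by case: (del i); rewrite //= expr0.
Qed.

Lemma avg_select (i j : 'I_n) : i != j ->
  avg (fun del : signs => (del i)%:R * (~~ del j)%:R) = 4^-1 :> R.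
Proof.
(* The indicators are (1 - sg del i)/2 and (1 + sg del j)/2, as [true] carries the sign -1; signs
   are centred and distinct ones uncorrelated, so only 1/4 survives. *)
move=> ij; rewrite (_ : (fun _ => _) = fun del : signs => 4^-1 + ((- 4^-1) * sg del i +
    (4^-1 * sg del j + (- 4^-1) * (sg del i * sg del j)))).
  by rewrite !avgD !avgZ avg_cst !avg_sg avg_sg2// !mulr0 !addr0.
apply/funext => del; rewrite /sg.
by case: (del i); case: (del j); rewrite /= ?expr0 ?expr1; lra.
Qed.

(* Decoupling by a random partition [del]: averaging over [del] multiplies the
   off-diagonal terms by 1/4, and the signs indexed by [del] are independent of
   the other ones, which [twist] makes explicit. *)
Lemma avg_nrm_chaos_le (a : 'I_d -> 'I_n -> 'I_n -> R) A :
  0 <= A -> (forall m, \sum_i \sum_(j | i != j) a m i j ^+ 2 <= A) ->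
  avg (fun e => nrm (fun m => \sum_i \sum_(j | i != j) sg e i * sg e j * a m i j))
  <= 64 * L * Num.sqrt A.
Proof.
move=> A0 aA; have L0 := ltW ln2d_gt0.
pose Z (del e : signs) m := \sum_i \sum_(j | i != j)
  (del i)%:R * (~~ del j)%:R * (sg e i * sg e j * a m i j).
have ZE e m : \sum_i \sum_(j | i != j) sg e i * sg e j * a m i j =
    4 * avg (fun del => Z del e m).
  rewrite avg_sum mulr_sumr; apply: eq_bigr => i _.
  rewrite avg_sum mulr_sumr; apply: eq_bigr => j ij.
  under [X in avg X]eq_fun do rewrite mulrC.
  by rewrite avgZ avg_select// mulrCA mulfV ?mulr1.
apply: (@le_trans _ _ (avg (fun e => 4 * avg (fun del => nrm (Z del e))))).
  apply: le_avg => e; under eq_fun do rewrite ZE.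
  by rewrite nrmZ ger0_norm// ler_pM2l// nrm_avg.
rewrite avgZ avg_exchange (_ : 64 * L * _ = 4 * (16 * L * Num.sqrt A)); last by ring.
rewrite ler_pM2l// -[leRHS](avg_cst n); apply: le_avg => del.
(* [B e] is the largest squared Euclidean norm of the coefficients of the linear forms in [sig]; it
   involves only signs outside [del]. The vectors are indexed by [i] and the signs by [j], hence the
   swapped arguments. *)
pose b m j i := if i != j then (del i)%:R * (~~ del j)%:R * a m i j else 0.
pose B e := nrm (fun m => \sum_i (\sum_j sg e j * b m j i) ^+ 2).
have AB : avg B <= 16 * L * A.
  apply: avg_nrm_sqr_le => // m; apply: le_trans (aA m).
  rewrite exchange_big/=; apply: ler_sum => i _; rewrite [leRHS]big_mkcond/=.
  apply: ler_sum => j _; rewrite /b; case: ifP => _; last by rewrite expr0n.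
  case: (del i) => /=; last by rewrite !mul0r expr0n sqr_ge0.
  case: (del j) => /=; last by rewrite !mul1r.
  by rewrite mulr0 mul0r expr0n sqr_ge0.
apply: (@le_trans _ _ (avg (fun sig => avg (fun e => nrm (Z del (twist del sig e)))))).
  rewrite -[leLHS](avg_cst n); apply: le_avg => sig.
  rewrite (avg_bij (h := twist del sig))//.
  by exists (twist del sig); exact: twistK.
rewrite avg_exchange.
apply: (@le_trans _ _ (avg (fun e => Num.sqrt (16 * L * B e)))).
  apply: le_avg => e.
  have -> : (fun sig => nrm (Z del (twist del sig e))) =
      fun sig => nrm (fun m => \sum_i sg sig i * (sg e i * \sum_j sg e j * b m j i)).
    apply/funext => sig; congr nrm; apply/funext => m; apply: eq_bigr => i _.
    rewrite big_mkcond/= !mulr_sumr; apply: eq_bigr => j _.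
    rewrite /b; case: ifP => _; last by rewrite !mulr0.
    rewrite !sg_twist; case: (del i) => /=; last by rewrite !(mul0r, mulr0).
    case: (del j) => /=; first by rewrite !(mulr0, mul0r).
    ring.
  apply: avg_nrm_le => [|m]; first exact: nrm_ge0.
  apply: le_trans (le_nrm (fun m => \sum_i (\sum_j sg e j * b m j i) ^+ 2) m).
  apply: le_trans (ler_norm _); apply: ler_sum => i _.
  by rewrite exprMn expr2 sgM mul1r.
(* The form in [sig] and [B] itself each cost [16 * L] under the root; the partition costs 4, whence
   64. *)
rewrite (_ : 16 * L * Num.sqrt A = Num.sqrt (16 * L * (16 * L * A))); last first.
  rewrite mulrA -expr2 sqrtrM ?sqr_ge0// sqrtr_sqr ger0_norm// mulr_ge0//.
apply: avg_le_sqrt.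
under [X in avg X]eq_fun => e do rewrite sqr_sqrtr ?mulr_ge0 ?nrm_ge0//.
by rewrite avgZ ler_wpM2l// mulr_ge0.
Qed.

End RademacherMaxima.

(** * Resampling one coordinate of an iid sample *)

Section TupleUpdate.
Context (dS : measure_display) (S : measurableType dS) (n : nat).
Implicit Types (x : n.-tuple S) (i : 'I_n).

Definition upd x i z : n.-tuple S := [tuple if j == i then z else tnth x j | j < n].

Lemma tnth_upd x i z j : tnth (upd x i z) j = if j == i then z else tnth x j.
Proof. by rewrite tnth_mktuple. Qed.

Lemma measurable_upd i :
  measurable_fun [set: n.-tuple S * S] (fun xz => upd xz.1 i xz.2).
Proof.
apply/measurable_fun_tnthP => j.
rewrite (_ : _ \o _ = fun xz : n.-tuple S * S => if j == i then xz.2 else tnth xz.1 j).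
  case: (j == i); first exact: measurable_snd.
  by apply: (measurableT_comp (measurable_tnth j)); exact: measurable_fst.
by apply/funext => xz /=; rewrite tnth_upd.
Qed.

Lemma measurable_upd_coord x i : measurable_fun setT (upd x i).
Proof.
apply/measurable_fun_tnthP => j.
rewrite (_ : _ \o _ = fun z => if j == i then z else tnth x j).
  by case: (j == i); [exact: measurable_id|exact: measurable_cst].
by apply/funext => z /=; rewrite tnth_upd.
Qed.

(** Boxes are stable under intersection, which the uniqueness theorem for measures needs and which
    preimages under single coordinates are not. *)
Lemma measurable_tuple_generators : @measurable _ (n.-tuple S) =
  <<s [set B | exists2 A : 'I_n -> set S, (forall i, measurable (A i)) &
               B = [set x | forall i, A i (tnth x i)]] >>.
Proof.
apply/seteqP; split.
  apply: smallest_sub; first exact: smallest_sigma_algebra.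
  rewrite -bigcup_seq/=; apply: bigcup_sub => i _ B [A mA <-].
  apply: sub_sigma_algebra; exists (fun j => if j == i then A else setT).
    by move=> j; case: ifP.
  apply/seteqP; split => x /=; first by move=> [_ Ax] j; case: eqVneq => // ->.
  by move=> /(_ i); rewrite eqxx; split.
apply: smallest_sub; first exact: sigma_algebra_measurable.
move=> B [A mA ->].
rewrite (_ : [set _ | _] = \bigcap_(i in [set: 'I_n])
    ((fun x : n.-tuple S => tnth x i) @^-1` A i)); last first.
  by apply/seteqP; split => x /= Ax i; [move=> _|]; exact: Ax.
apply: fin_bigcap_measurable => [|i _]; first exact: finite_finset.
by rewrite -[X in measurable X]setTI; exact: measurable_tnth.
Qed.

End TupleUpdate.

Section Resampling.
Context (R : realType) (dW dS : measure_display) (W : measurableType dW)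
  (S : measurableType dS) (P : probability W R) (n : nat) (X : 'I_n -> {RV P >-> S})
  (mu : probability S R).
Hypothesis indepX : mutually_independent X.
Hypothesis lawX : forall i A, measurable A -> P (X i @^-1` A) = mu A.

Definition sample (w : W) : n.-tuple S := [tuple X i w | i < n].

Lemma measurable_sample : measurable_fun setT sample.
Proof.
apply/measurable_fun_tnthP => i.
rewrite (_ : _ \o _ = X i); first exact: measurable_funPT.
by apply/funext => w /=; rewrite tnth_mktuple.
Qed.

Let measurable_sample_upd i :
  measurable_fun [set: W * S] (fun wz => upd (sample wz.1) i wz.2).
Proof.
apply: (measurableT_comp (f := fun xz : n.-tuple S * S => upd xz.1 i xz.2)
  (g := fun wz : W * S => (sample wz.1, wz.2))); first exact: measurable_upd.
apply: measurable_fun_pair; last exact: measurable_snd.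
by apply: (measurableT_comp measurable_sample); exact: measurable_fst.
Qed.

Let setG := [set B | exists2 A : 'I_n -> set S, (forall i, measurable (A i)) &
               B = [set x : n.-tuple S | forall i, A i (tnth x i)]].

(* The push-forward measures are named because their canonical instance cannot
   infer the measurability proof it depends on. *)
Let law : {measure set (n.-tuple S) -> \bar R} :=
  measure_function_pushforward__canonical__measure_function_Measure P measurable_sample.

Let law_upd i : {measure set (n.-tuple S) -> \bar R} :=
  measure_function_pushforward__canonical__measure_function_Measure
    (P \x mu)%E (measurable_sample_upd i).

(** Both laws agree on boxes by independence, applied to all indices and to all indices but [i].
    This one-coordinate form takes the place of an n-fold product measure. *)
Lemma sample_law i (B : set (n.-tuple S)) : measurable B -> law B = law_upd i B.
Proof.
move=> mB.
apply: (@measure_unique _ R _ setG (fun=> setT) _ _ _ _ law (law_upd i)) => //.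
- exact: measurable_tuple_generators.
- move=> _ _ [A mA ->] [B' mB' ->]; exists (fun i => A i `&` B' i).
    by move=> j; exact: measurableI.
  apply/seteqP; split => x /=; first by move=> [Ax Bx] j; split.
  by move=> ABx; split => j; have [] := ABx j.
- by move=> _; exists (fun=> setT) => //; apply/seteqP; split.
- by rewrite bigcup_const//; exists 0%N.
- move=> _ [A mA ->]; rewrite /law /law_upd /= /pushforward/=.
  pose J : {set 'I_n} := [set: 'I_n]%SET; pose J' : {set 'I_n} := (~: [set i])%SET.
  have E1 : sample @^-1` [set x | forall i, A i (tnth x i)] =
      \bigcap_(j in [set` J]) (X j @^-1` A j).
    apply/seteqP; split => w /= Aw j.
      by move=> _; have := Aw j; rewrite tnth_mktuple.
    by rewrite tnth_mktuple; apply: Aw; rewrite /= inE.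
  have E2 : (fun wz : W * S => upd (sample wz.1) i wz.2) @^-1`
        [set x | forall i, A i (tnth x i)] =
      (\bigcap_(j in [set` J']) (X j @^-1` A j)) `*` A i.
    apply/seteqP; split => -[w z] /=.
      move=> Aw; split => [j|]; last by have := Aw i; rewrite tnth_upd eqxx.
      rewrite /= !inE => ji; have := Aw j.
      by rewrite tnth_upd (negbTE ji) tnth_mktuple.
    move=> [Aw Az] j; rewrite tnth_upd; case: eqVneq => [->//|ji].
    by rewrite tnth_mktuple; apply: Aw; rewrite /= !inE.
  rewrite E1 E2 product_measure1E//; last first.
    apply: fin_bigcap_measurable => [|j _]; first exact: finite_finset.
    by rewrite -[X in measurable X]setTI; exact: measurable_funPT.
  rewrite (indepX (J := J))//.
  transitivity ((\prod_(j in J') P (X j @^-1` A j)) * mu (A i))%E; last first.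
    by congr (_ * _)%E; apply/esym/indepX.
  rewrite (bigD1 i) ?inE//= lawX// muleC; congr (_ * _)%E.
  by apply: eq_bigl => j; rewrite !inE.
- by move=> _; rewrite /law /= /pushforward preimage_setT probability_setT ltry.
Qed.

Lemma resampling i (phi : n.-tuple S -> \bar R) : measurable_fun [set: n.-tuple S] phi ->
  (forall x, 0 <= phi x)%E ->
  (\int[P]_w phi (sample w) = \int[P]_w \int[mu]_z phi (upd (sample w) i z))%E.
Proof.
move=> mphi phi0.
have := @fubini_tonelli1 _ _ _ _ R P mu (fun wz => phi (upd (sample wz.1) i wz.2)).
rewrite /fubini_F /= => <-//; last first.
  exact: (measurableT_comp mphi (measurable_sample_upd i)).
transitivity (\int[law]_x phi x)%E.
  by rewrite (ge0_integral_pushforward measurable_sample).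
rewrite (eq_measure_integral (law_upd i)) => [|B mB _]; last exact: sample_law.
by rewrite (ge0_integral_pushforward (measurable_sample_upd i)).
Qed.

Lemma measurable_resampling i (phi : n.-tuple S -> \bar R) :
  measurable_fun [set: n.-tuple S] phi ->
  (forall x, 0 <= phi x)%E ->
  measurable_fun setT (fun w => \int[mu]_z phi (upd (sample w) i z))%E.
Proof.
move=> mphi phi0.
apply: (measurable_fun_fubini_tonelli_F (fun wz => phi (upd (sample wz.1) i wz.2))) => //.
exact: (measurableT_comp mphi (measurable_sample_upd i)).
Qed.

Lemma le_resampling i (phi psi : n.-tuple S -> \bar R) :
  measurable_fun [set: n.-tuple S] phi -> measurable_fun [set: n.-tuple S] psi ->
  (forall x, 0 <= phi x)%E -> (forall x, 0 <= psi x)%E ->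
  (forall x, \int[mu]_z phi (upd x i z) <= \int[mu]_z psi (upd x i z))%E ->
  (\int[P]_w phi (sample w) <= \int[P]_w psi (sample w))%E.
Proof.
move=> mphi mpsi phi0 psi0 pp; rewrite !(resampling i)//.
apply: ge0_le_integral => //.
- by move=> w _; exact: integral_ge0.
- exact: measurable_resampling.
- exact: measurable_resampling.
Qed.

End Resampling.

Section MeasurableNrm.
Context (R : realType) (dT : measure_display) (T : measurableType dT) (d : nat).

Lemma measurable_bigmax (I : Type) (s : seq I) (Q : pred I) (F : I -> T -> R) :
  (forall i, measurable_fun setT (F i)) ->
  measurable_fun setT (fun x => \big[Num.max/0]_(i <- s | Q i) F i x).
Proof.
move=> mF; elim: s => [|i s IH].
  by under eq_fun do rewrite big_nil; exact: measurable_cst.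
under eq_fun do rewrite big_cons; case: (Q i) => //.
exact: measurable_maxr.
Qed.

Lemma measurable_nrm (F : T -> 'I_d -> R) :
  (forall m, measurable_fun setT (F ^~ m)) ->
  measurable_fun setT (fun x => nrm (F x)).
Proof.
by move=> mF; apply: measurable_bigmax => m; exact: measurableT_comp.
Qed.

Lemma measurable_avg n (phi : {ffun 'I_n -> bool} -> T -> R) :
  (forall e, measurable_fun setT (phi e)) ->
  measurable_fun setT (fun x => avg (phi ^~ x)).
Proof.
by move=> mphi; apply: measurable_funM => //; exact: measurable_sum.
Qed.

Lemma integral_avg (mu : {measure set T -> \bar R}) n
    (phi : {ffun 'I_n -> bool} -> T -> R) :
  (forall e, measurable_fun setT (phi e)) -> (forall e x, 0 <= phi e x) ->
  (\int[mu]_x (avg (phi ^~ x))%:E =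
   ((2 ^+ n)^-1)%:E * \sum_e \int[mu]_x (phi e x)%:E)%E.
Proof.
move=> mphi phi0; rewrite /avg.
under eq_integral do rewrite EFinM -sumEFin.
rewrite ge0_integralZl_EFin//; last 2 first.
- by move=> x _; apply: sume_ge0 => e _; rewrite lee_fin.
- by apply: emeasurable_sum => e; exact/measurable_EFinP.
- by rewrite ge0_integral_sum//= => [e|e x _]; [exact/measurable_EFinP|rewrite lee_fin].
Qed.

Lemma EFin_nrm_le (v : 'I_d -> R) (r : \bar R) : (0 <= r)%E ->
  (forall m, `|v m|%:E <= r)%E -> ((nrm v)%:E <= r)%E.
Proof.
case: r => [r| |//]; last by move=> *; rewrite leey.
by rewrite !lee_fin => r0 vr; apply: nrm_le => // m; have := vr m; rewrite lee_fin.
Qed.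

End MeasurableNrm.

(** * Symmetrization *)

Section OneCoordinate.
Context (R : realType) (dS : measure_display) (S : measurableType dS)
  (mu : probability S R) (d : nat).
Variables (y : 'I_d -> R) (F : 'I_d -> S -> R).
Hypothesis intF : forall m, mu.-integrable setT (EFin \o F m).

Let c m := (\int[mu]_z F m z)%R.

Let measF m : measurable_fun setT (F m).
Proof. by have /integrableP[/measurable_EFinP] := intF m. Qed.

(* [y + F = ((y + c + 2 F) + (y - c)) / 2], and [y - c] is the expectation of
   [y + c - 2 F]. *)
Lemma integral_nrm_symmetrize :
  (\int[mu]_z (nrm (fun m => y m + F m z))%:E <=
   \int[mu]_z (2^-1 * (nrm (fun m => y m + 1 * c m + 2 * F m z) +
                       nrm (fun m => y m + 1 * c m + (- 2) * F m z)))%:E)%E.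
Proof.
have mnrm (u : 'I_d -> R) a : measurable_fun setT (fun z => nrm (fun m => u m + a * F m z)).
  apply: measurable_nrm => m; apply: measurable_funD => //.
  exact: measurable_funM.
have lep : ((nrm (fun m => y m - c m))%:E <=
    \int[mu]_z (nrm (fun m => y m + 1 * c m + (- 2) * F m z)%R)%:E)%E.
  apply: EFin_nrm_le => [|m].
    by apply: integral_ge0 => z _; rewrite lee_fin nrm_ge0.
  have intG : mu.-integrable setT (EFin \o (fun z => y m + 1 * c m + (- 2) * F m z)).
    rewrite (_ : _ \o _ = (cst (y m + 1 * c m)%:E \+ (fun z => (- 2)%:E * (EFin \o F m) z))%E).
      apply: integrableD => //; first exact: finite_measure_integrable_cst.
      exact: integrableZl.
    by apply/funext => z /=; rewrite EFinD EFinM.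
  have -> : y m - c m = (\int[mu]_z (y m + 1 * c m + (- 2) * F m z))%R.
    rewrite RintegralD//; last 2 first.
      exact: finite_measure_integrable_cst.
      rewrite (_ : _ \o _ = (fun z => (- 2)%:E * (EFin \o F m) z)%E); first exact: integrableZl.
      by apply/funext => z /=; rewrite EFinM.
    rewrite Rintegral_cst// RintegralZl//.
    rewrite (_ : fine _ = 1); last exact: (congr1 fine (probability_setT mu)).
    rewrite -/(c m); ring.
  apply: (@le_trans _ _ (\int[mu]_z `|(y m + 1 * c m + (- 2) * F m z)%:E|)%E).
    rewrite EFin_normr_Rintegral//; apply: le_abse_integral => //.
    by have /integrableP[] := intG.
  apply: ge0_le_integral => //.
  - apply/measurable_EFinP; apply: measurableT_comp => //.
    by apply: measurable_funD => //; exact: measurable_funM.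
  - by apply/measurable_EFinP; exact: mnrm.
  - by move=> z _; rewrite lee_fin; exact: (le_nrm (fun m => y m + 1 * c m + -2 * F m z)).
have halves (u v : S -> R) : measurable_fun setT u -> measurable_fun setT v ->
    (forall z, 0 <= u z) -> (forall z, 0 <= v z) ->
    (\int[mu]_z (2^-1 * (u z + v z))%:E =
     (2^-1)%:E * (\int[mu]_z (u z)%:E + \int[mu]_z (v z)%:E))%E.
  move=> mu_ mv u0 v0; rewrite -ge0_integralD//; last 4 first.
  - by move=> z _; rewrite lee_fin.
  - exact/measurable_EFinP.
  - by move=> z _; rewrite lee_fin.
  - exact/measurable_EFinP.
  rewrite -ge0_integralZl_EFin//.
  - by move=> z _; rewrite adde_ge0// lee_fin.
  - by apply: emeasurable_funD; exact/measurable_EFinP.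
apply: (@le_trans _ _ (\int[mu]_z (2^-1 * (nrm (fun m => y m + 1 * c m + 2 * F m z) +
                       nrm (fun m => y m - c m)))%:E)%E).
  apply: ge0_le_integral => //.
  - by move=> z _; rewrite lee_fin nrm_ge0.
  - apply/measurable_EFinP; rewrite (_ : (fun z => _) = fun z => nrm (fun m => y m + 1 * F m z)) //.
    by apply/funext => z; congr nrm; apply/funext => m; rewrite mul1r.
  - apply/measurable_EFinP; apply: measurable_funM => //.
    by apply: measurable_funD => //; exact: mnrm.
  - move=> z _; rewrite lee_fin.
    rewrite -[leRHS](mul1r) -[X in X * _](ger0_norm (ler01)) -[X in X * _]normr_id.
    apply: le_trans (_ : _ <= 2^-1 * nrm (fun m => (y m + 1 * c m + 2 * F m z) + (y m - c m))) _.
      rewrite -[X in X * _](ger0_norm (_ : 0 <= 2^-1))// -nrmZ.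
      apply: le_nrm2 => m; rewrite (_ : 2^-1 * _ = y m + F m z)//; lra.
    by rewrite normr_id normr1 mul1r ler_pM2l// nrmD.
have -> := halves _ (fun=> nrm (fun m => y m - c m)) (mnrm _ 2) (measurable_cst _)
  (fun=> nrm_ge0 _) (fun=> nrm_ge0 _).
have -> := halves _ _ (mnrm _ 2) (mnrm _ (- 2)) (fun=> nrm_ge0 _) (fun=> nrm_ge0 _).
rewrite lee_pmul2l// leeD2l//.
apply: le_trans lep; rewrite integral_cst//.
rewrite [X in (_ * X)%E](_ : _ = 1%E); last exact: probability_setT.
by rewrite mule1.
Qed.

End OneCoordinate.

Section Symmetrization.
Context (R : realType) (dW dS : measure_display) (W : measurableType dW)
  (S : measurableType dS) (P : probability W R) (n : nat) (X : 'I_n -> {RV P >-> S})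
  (mu : probability S R).
Hypothesis indepX : mutually_independent X.
Hypothesis lawX : forall i A, measurable A -> P (X i @^-1` A) = mu A.

Definition set_coord (pi : 'I_n -> R * R) i (ab : R * R) : 'I_n -> R * R :=
  fun j => if j == i then ab else pi j.

(* In coordinate [i] the weights [(a, b)] stand for the operator [a E_i + b Id],
   [E_i] being the expectation in the [i]-th variable. *)
Definition operator_weighted d (Phi : ('I_n -> R * R) -> n.-tuple S -> 'I_d -> R) :=
  forall i pi x, exists (y : 'I_d -> R) (F : 'I_d -> S -> R),
    (forall m, mu.-integrable setT (EFin \o F m)) /\
    forall a b z m, Phi (set_coord pi i (a, b)) (upd x i z) m =
      y m + a * (\int[mu]_z F m z)%R + b * F m z.

(** The coordinates pass one at a time from the identity to E_i + 2 e_i. Resampling freezes all the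
    others, which leaves the one-variable inequality [integral_nrm_symmetrize], the two values of
    the new sign giving its two terms. *)
Lemma symmetrization d (Phi : ('I_n -> R * R) -> n.-tuple S -> 'I_d -> R) :
  (forall pi m, measurable_fun [set: n.-tuple S] (fun x => Phi pi x m)) ->
  operator_weighted Phi ->
  (\int[P]_w (nrm (Phi (fun=> (0, 1)) (sample X w)))%:E <=
   \int[P]_w (avg (fun e => nrm (Phi (fun i => (1, 2 * sg e i)) (sample X w))))%:E)%E.
Proof.
move=> mPhi wPhi.
(* Hybrid weights: converted below [k], identity from [k] on. Hence [w k] does not involve the sign
   of index [k], the next one to be introduced. *)
pose w k (e : {ffun 'I_n -> bool}) (i : 'I_n) : R * R :=
  if (i < k)%N then (1, 2 * sg e i) else (0, 1).
pose phi k (x : n.-tuple S) := avg (fun e => nrm (Phi (w k e) x)).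
have mnrm k e : measurable_fun [set: n.-tuple S] (fun x => nrm (Phi (w k e) x)).
  by apply: measurable_nrm => m; exact: mPhi.
have mphi k : measurable_fun [set: n.-tuple S] (EFin \o phi k).
  by apply/measurable_EFinP; apply: measurable_avg => e; exact: mnrm.
have phi0 k x : (0 <= (phi k x)%:E)%E.
  by rewrite lee_fin; apply: avg_ge0 => e; exact: nrm_ge0.
suff step k : (k < n)%N -> (\int[P]_w (phi k (sample X w))%:E <=
                            \int[P]_w (phi k.+1 (sample X w))%:E)%E.
  have all_steps k : (k <= n)%N -> (\int[P]_w (phi 0 (sample X w))%:E <=
                            \int[P]_w (phi k (sample X w))%:E)%E.
    elim: k => [//|k IH kn]; exact: le_trans (IH (ltnW kn)) (step _ kn).
  have := all_steps n (leqnn n).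
  have -> : phi 0 = fun x => nrm (Phi (fun=> (0, 1)) x).
      by apply/funext => x; rewrite -[RHS](avg_cst n).
  have -> // : phi n = fun x => avg (fun e => nrm (Phi (fun i => (1, 2 * sg e i)) x)).
  apply/funext => x; congr avg; apply/funext => e; congr (nrm (Phi _ x)).
  by apply/funext => i; rewrite /w ltn_ord.
move=> kn; pose i := Ordinal kn.
apply: (le_resampling indepX lawX (i := i) (phi := EFin \o phi k)
  (psi := EFin \o phi k.+1)) => // [x|x|x]; [exact: phi0|exact: phi0|].
have munrm l e : measurable_fun setT (fun z => nrm (Phi (w l e) (upd x i z))).
  exact: (measurableT_comp (mnrm l e) (measurable_upd_coord x i)).
rewrite [X in (_ <= X)%E](_ : _ = \int[mu]_z (avg (fun e => 2^-1 *
    (nrm (Phi (w k.+1 e) (upd x i z)) +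
     nrm (Phi (w k.+1 (flip i e)) (upd x i z)))))%:E)%E; last first.
  by apply: eq_integral => z _; rewrite /phi /= (avg_flip i).
rewrite [X in (X <= _)%E](_ : _ = \int[mu]_z (avg (fun e =>
    nrm (Phi (w k e) (upd x i z))))%:E)%E //.
rewrite !integral_avg//; last 3 first.
- move=> e; apply: measurable_funM => //; apply: measurable_funD; exact: munrm.
- by move=> e z; rewrite mulr_ge0 ?addr_ge0 ?nrm_ge0.
- by move=> e z; exact: nrm_ge0.
rewrite lee_pmul2l// ?lte_fin ?invr_gt0 ?exprn_gt0//.
apply: lee_sum => e _.
have [y [F [intF PhiE]]] := wPhi i (w k e) x.
have w0 : w k e = set_coord (w k e) i (0, 1).
  apply/funext => j; rewrite /set_coord; case: eqVneq => // ->.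
  by rewrite /w ltnn.
have wS (e' : {ffun 'I_n -> bool}) : (forall j, j != i -> e' j = e j) ->
    w k.+1 e' = set_coord (w k e) i (1, 2 * sg e' i).
  move=> ee; apply/funext => j; rewrite /set_coord /w; case: eqVneq => [->|ji].
    by rewrite ltnSn.
  rewrite ltnS leq_eqVlt -(inj_eq val_inj) /= in ji *.
  by rewrite (negbTE ji)/= /sg ee.
rewrite {1}w0 (wS e)// (wS (flip i e)); last first.
  by move=> j ji; rewrite ffunE (negbTE ji) addbF.
rewrite sg_flip eqxx.
have E a b z : Phi (set_coord (w k e) i (a, b)) (upd x i z) =
    fun m => y m + a * (\int[mu]_z F m z)%R + b * F m z.
  by apply/funext => m; exact: PhiE.
have L z : nrm (Phi (set_coord (w k e) i (0, 1)) (upd x i z)) =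
    nrm (fun m => y m + F m z).
  by rewrite E; congr nrm; apply/funext => m; rewrite mul0r addr0 mul1r.
under eq_integral do rewrite L.
under [X in (_ <= X)%E]eq_integral do rewrite !E.
(* If [e i] is true the sign is -1, and the two terms come in the opposite order. *)
rewrite /sg; case: (e i); rewrite /= ?expr0 ?expr1 ?mulr1 ?mulrN1 ?opprK ?mulr1.
  under [X in (_ <= X)%E]eq_integral do rewrite [X in _ * X]addrC.
  exact: integral_nrm_symmetrize.
exact: integral_nrm_symmetrize.
Qed.

End Symmetrization.

Section RintegralSum.
Context (R : realType) (dT : measure_display) (T : measurableType dT)
  (mu : {measure set T -> \bar R}).

Lemma integrableZD (a b : R) (f g : T -> R) :
  mu.-integrable setT (EFin \o f) -> mu.-integrable setT (EFin \o g) ->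
  mu.-integrable setT (EFin \o (fun x => a * f x + b * g x)).
Proof.
move=> If Ig.
rewrite (_ : _ \o _ = (fun z => a%:E * (EFin \o f) z) \+ (fun z => b%:E * (EFin \o g) z))%E.
  by apply: integrableD => //; exact: integrableZl.
by apply/funext => z /=; rewrite EFinD !EFinM.
Qed.

Lemma RintegralZD (a b : R) (f g : T -> R) :
  mu.-integrable setT (EFin \o f) -> mu.-integrable setT (EFin \o g) ->
  \int[mu]_x (a * f x + b * g x) = a * \int[mu]_x f x + b * \int[mu]_x g x.
Proof.
move=> If Ig.
have IZ c k : mu.-integrable setT (EFin \o k) ->
    mu.-integrable setT (EFin \o (fun x => c * k x)).
  move=> Ik; rewrite (_ : _ \o _ = (fun z => c%:E * (EFin \o k) z)%E); first exact: integrableZl.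
  by apply/funext => z /=; rewrite EFinM.
by rewrite RintegralD ?RintegralZl//; exact: IZ.
Qed.

Lemma integrable_Rsum (I : Type) (s : seq I) (Q : pred I) (f : I -> T -> R) :
  (forall i, mu.-integrable setT (EFin \o f i)) ->
  mu.-integrable setT (EFin \o (fun x => \sum_(i <- s | Q i) f i x)).
Proof.
move=> If; elim: s => [|i s IH].
  rewrite (_ : _ \o _ = cst 0%E); first exact: integrable0.
  by apply/funext => x /=; rewrite big_nil.
rewrite (_ : _ \o _ = EFin \o (fun x => (Q i)%:R * f i x + 1 * \sum_(j <- s | Q j) f j x)).
  exact: integrableZD.
by apply/funext => x /=; rewrite big_cons mul1r; case: (Q i); rewrite ?mul1r// mul0r add0r.
Qed.

Lemma Rintegral_sum (I : Type) (s : seq I) (Q : pred I) (f : I -> T -> R) :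
  (forall i, mu.-integrable setT (EFin \o f i)) ->
  \int[mu]_x (\sum_(i <- s | Q i) f i x) = \sum_(i <- s | Q i) \int[mu]_x f i x.
Proof.
move=> If; elim: s => [|i s IH].
  rewrite big_nil; under eq_Rintegral do rewrite big_nil.
  by rewrite /Rintegral integral0.
rewrite big_cons -IH.
rewrite (_ : \int[mu]_x _ = \int[mu]_x ((Q i)%:R * f i x + 1 * \sum_(j <- s | Q j) f j x)).
  rewrite RintegralZD//; last exact: integrable_Rsum.
  by case: (Q i); rewrite !mul1r// mul0r add0r.
apply: eq_Rintegral => x _.
by rewrite big_cons mul1r; case: (Q i); rewrite ?mul1r// mul0r add0r.
Qed.

End RintegralSum.

Section SumSymmetrization.
Context (R : realType) (dW dS : measure_display) (W : measurableType dW)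
  (S : measurableType dS) (P : probability W R) (n : nat) (X : 'I_n -> {RV P >-> S})
  (mu : probability S R).
Hypothesis indepX : mutually_independent X.
Hypothesis lawX : forall i A, measurable A -> P (X i @^-1` A) = mu A.
Context (d : nat).

Definition mean (phi : n.-tuple S -> R) : \bar R := (\int[P]_w (phi (sample X w))%:E)%E.
Local Notation Ex := mean.

Lemma sum_symmetrization (u : 'I_d -> S -> R) :
  (forall m, mu.-integrable setT (EFin \o u m)) ->
  (Ex (fun x => nrm (fun m => \sum_i u m (tnth x i)))%R <=
   Ex (fun x => avg (fun e => nrm (fun m =>
     \sum_i ((\int[mu]_z u m z)%R + 2 * sg e i * u m (tnth x i)))))%R)%E.
Proof.
move=> Iu.
pose Phi (pi : 'I_n -> R * R) (x : n.-tuple S) m :=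
  \sum_i ((pi i).1 * (\int[mu]_z u m z)%R + (pi i).2 * u m (tnth x i)).
have mu_ m : measurable_fun setT (u m) by have /integrableP[/measurable_EFinP] := Iu m.
have mPhi pi m : measurable_fun [set: n.-tuple S] (fun x => Phi pi x m).
  apply: measurable_sum => i; apply: measurable_funD => //; apply: measurable_funM => //.
  exact: measurableT_comp (measurable_tnth i).
have wPhi : operator_weighted mu Phi.
  move=> i pi x; exists (fun m => \sum_(j | j != i)
    ((pi j).1 * (\int[mu]_z u m z)%R + (pi j).2 * u m (tnth x j))), u; split=> // a b z m.
  rewrite /Phi (bigD1 i)//= addrC /set_coord eqxx tnth_upd eqxx /= -addrA; congr (_ + _).
  by apply: eq_bigr => j ji; rewrite (negbTE ji) tnth_upd (negbTE ji).
have := symmetrization indepX lawX mPhi wPhi; congr (_ <= _)%E; apply: eq_integral => w _.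
  by congr (nrm _)%:E; apply/funext => m; apply: eq_bigr => i _; rewrite mul0r add0r mul1r.
congr (avg _)%:E; apply/funext => e; congr nrm; apply/funext => m.
by apply: eq_bigr => i _; rewrite mul1r.
Qed.

Variables (h : 'I_d -> S -> S -> R).
Hypothesis hsym : forall m x y, h m x y = h m y x.
Hypothesis mh : forall m, measurable_fun [set: S * S] (fun z => h m z.1 z.2).
Hypothesis Ih : forall m x, mu.-integrable setT (EFin \o h m x).

(** The g_m of the overview. It is left uncentred, so that it stays nonnegative for a nonnegative
    kernel. *)
Definition proj1 m x : R := (\int[mu]_y h m x y)%R.

Hypothesis Ig : forall m, mu.-integrable setT (EFin \o proj1 m).

Definition proj0 m : R := (\int[mu]_x proj1 m x)%R.

Lemma measurable_pair (i j : 'I_n) m :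
  measurable_fun [set: n.-tuple S] (fun x => h m (tnth x i) (tnth x j)).
Proof.
apply: (measurableT_comp (f := fun z : S * S => h m z.1 z.2)
  (g := fun x : n.-tuple S => (tnth x i, tnth x j))) => //.
by apply: measurable_fun_pair; exact: measurable_tnth.
Qed.

(** The four terms are the expansion of (E_i + 2 e_i)(E_j + 2 e_j) h. Since i != j, the two weights
    in a product never belong to the same coordinate, so the dependence on each coordinate has the
    form [operator_weighted] asks for. *)
Lemma pair_symmetrization :
  (Ex (fun x => nrm (fun m => \sum_i \sum_(j | i != j) h m (tnth x i) (tnth x j)))%R <=
   Ex (fun x => avg (fun e => nrm (fun m => \sum_i \sum_(j | i != j)
     (4 * (sg e i * sg e j * h m (tnth x i) (tnth x j)) +
      2 * sg e i * proj1 m (tnth x i) + 2 * sg e j * proj1 m (tnth x j) + proj0 m))))%R)%E.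
Proof.
pose T (pi : 'I_n -> R * R) (x : n.-tuple S) m i j :=
  (pi i).2 * (pi j).2 * h m (tnth x i) (tnth x j) +
  (pi i).2 * (pi j).1 * proj1 m (tnth x i) +
  (pi i).1 * (pi j).2 * proj1 m (tnth x j) + (pi i).1 * (pi j).1 * proj0 m.
pose Phi pi x m := \sum_i \sum_(j | i != j) T pi x m i j.
have mg m : measurable_fun setT (proj1 m).
  by have /integrableP[/measurable_EFinP] := Ig m.
have mgt i m : measurable_fun [set: n.-tuple S] (fun x => proj1 m (tnth x i)).
  exact: measurableT_comp (measurable_tnth i).
have mPhi pi m : measurable_fun [set: n.-tuple S] (fun x => Phi pi x m).
  apply: measurable_sum => i; under eq_fun do rewrite big_mkcond.
  apply: measurable_sum => j; case: (i != j) => //.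
  apply: measurable_funD => //; apply: measurable_funD; last exact: measurable_funM.
  apply: measurable_funD; last exact: measurable_funM.
  by apply: measurable_funM => //; exact: measurable_pair.
have Ih' m y : mu.-integrable setT (EFin \o h m ^~ y).
  by rewrite (_ : h m ^~ y = h m y)//; apply/funext => x; exact: hsym.
have wPhi : operator_weighted mu Phi.
  move=> i pi x.
  (* [F] collects the pairs containing [i], the factor 2 merging (i, j) with (j, i) by symmetry of
     [h]. The pairs avoiding [i] form the constant part. *)
  pose F m z := \sum_(j | j != i) ((2 * (pi j).2) * h m z (tnth x j) + (2 * (pi j).1) * proj1 m z).
  have IF m : mu.-integrable setT (EFin \o F m).
    by apply: integrable_Rsum => j; exact: integrableZD.
  have cF m : \int[mu]_z F m z =
      \sum_(j | j != i) ((2 * (pi j).2) * proj1 m (tnth x j) + (2 * (pi j).1) * proj0 m).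
    rewrite Rintegral_sum => [|j]; last exact: integrableZD.
    apply: eq_bigr => j _; rewrite RintegralZD//; congr (_ * _ + _).
    by apply: eq_Rintegral => z _; rewrite hsym.
  exists (fun m => \sum_(k | k != i) \sum_(l | (k != l) && (l != i)) T pi x m k l), F.
  split=> // a b z m; rewrite cF.
  set pi' := set_coord pi i (a, b); set x' := upd x i z.
  have pii : pi' i = (a, b) by rewrite /pi' /set_coord eqxx.
  have xi : tnth x' i = z by rewrite tnth_upd eqxx.
  have pij j : j != i -> pi' j = pi j by move=> ji; rewrite /pi' /set_coord (negbTE ji).
  have xj j : j != i -> tnth x' j = tnth x j by move=> ji; rewrite tnth_upd (negbTE ji).
  rewrite /Phi (bigD1 i)//=.
  have -> : \sum_(k | k != i) \sum_(l | k != l) T pi' x' m k l =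
      \sum_(k | k != i) T pi' x' m k i +
      \sum_(k | k != i) \sum_(l | (k != l) && (l != i)) T pi x m k l.
    rewrite -big_split/=; apply: eq_bigr => k ki; rewrite (bigD1 i)//=; congr (_ + _).
    by apply: eq_bigr => l /andP[kl li]; rewrite /T !pij ?xj.
  rewrite addrA addrC -addrA; congr (_ + _).
  under eq_bigl do rewrite eq_sym.
  rewrite !mulr_sumr -!big_split/=; apply: eq_bigr => j ji.
  rewrite /T pii xi pij ?xj//= (hsym m (tnth x j) z); ring.
have := symmetrization indepX lawX mPhi wPhi; congr (_ <= _)%E; apply: eq_integral => w _.
  congr (nrm _)%:E; apply/funext => m; apply: eq_bigr => i _; apply: eq_bigr => j _.
  by rewrite /T /=; ring.
congr (avg _)%:E; apply/funext => e; congr nrm; apply/funext => m.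
apply: eq_bigr => i _; apply: eq_bigr => j _.
by rewrite /T /=; ring.
Qed.

End SumSymmetrization.

(** * Maximal inequalities *)

Section IntegralBounds.
Context (R : realType) (dT : measure_display) (T : measurableType dT).
Implicit Types (phi psi : T -> R).

Lemma measurable_sqrt phi : measurable_fun setT phi ->
  measurable_fun setT (fun x => Num.sqrt (phi x)).
Proof.
move=> mphi; apply: (measurableT_comp (f := @Num.sqrt R)) => //.
by apply: continuous_measurable_fun; exact: sqrt_continuous.
Qed.

Section Measure.
Context (mu : {measure set T -> \bar R}).

Lemma ge0_le_integral_EFin phi psi : measurable_fun setT phi -> measurable_fun setT psi ->
  (forall x, 0 <= phi x) -> (forall x, phi x <= psi x) ->
  (\int[mu]_x (phi x)%:E <= \int[mu]_x (psi x)%:E)%E.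
Proof.
move=> mphi mpsi phi0 pp; apply: ge0_le_integral => //.
- by move=> x _; rewrite lee_fin.
- exact/measurable_EFinP.
- exact/measurable_EFinP.
- by move=> x _; rewrite lee_fin.
Qed.

Lemma ge0_integralD_EFin phi psi : measurable_fun setT phi -> measurable_fun setT psi ->
  (forall x, 0 <= phi x) -> (forall x, 0 <= psi x) ->
  (\int[mu]_x (phi x + psi x)%:E = \int[mu]_x (phi x)%:E + \int[mu]_x (psi x)%:E)%E.
Proof.
move=> mphi mpsi phi0 psi0; under eq_integral do rewrite EFinD.
rewrite ge0_integralD//.
- by move=> x _; rewrite lee_fin.
- exact/measurable_EFinP.
- by move=> x _; rewrite lee_fin.
- exact/measurable_EFinP.
Qed.

Lemma ge0_integralZ_EFin k phi : measurable_fun setT phi ->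
  (forall x, 0 <= phi x) -> 0 <= k ->
  (\int[mu]_x (k * phi x)%:E = k%:E * \int[mu]_x (phi x)%:E)%E.
Proof.
move=> mphi phi0 k0; under eq_integral do rewrite EFinM.
rewrite ge0_integralZl_EFin//.
- by move=> x _; rewrite lee_fin.
- exact/measurable_EFinP.
Qed.

End Measure.

Context (mu : probability T R).

Lemma integral_cst_EFin (k : R) : (\int[mu]_x k%:E = k%:E)%E.
Proof.
rewrite integral_cst// [X in (_ * X)%E](_ : _ = 1%E) ?mule1//.
exact: probability_setT.
Qed.

Lemma integrable_bounded phi C : measurable_fun setT phi ->
  (forall x, 0 <= phi x <= C) -> mu.-integrable setT (EFin \o phi).
Proof.
move=> mphi phiC; apply: (le_integrable measurableT (g := cst C%:E)) => //.
- exact/measurable_EFinP.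
- move=> x _ /=; have /andP[p0 pC] := phiC x.
  by rewrite lee_fin !ger0_norm// (le_trans p0).
- exact: finite_measure_integrable_cst.
Qed.

Lemma ge0_EFin_Rintegral_le phi (k : R) : (forall x, 0 <= phi x) ->
  (\int[mu]_x (phi x)%:E <= k%:E)%E -> \int[mu]_x phi x <= k.
Proof.
move=> phi0 h; rewrite -lee_fin /Rintegral fineK//.
rewrite ge0_fin_numE ?(le_lt_trans h) ?ltry//.
by apply: integral_ge0 => x _; rewrite lee_fin.
Qed.

(** Integrates 2 c phi <= phi^2 + c^2 with c the mean of [phi]; nothing is subtracted under the
    integral, and the right-hand side may be infinite. *)
Lemma sqr_Rintegral_le phi : mu.-integrable setT (EFin \o phi) -> (forall x, 0 <= phi x) ->
  (((\int[mu]_x phi x)%R ^+ 2)%:E <= \int[mu]_x (phi x ^+ 2)%:E)%E.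
Proof.
move=> Iphi phi0; have mphi : measurable_fun setT phi.
  by have /integrableP[/measurable_EFinP] := Iphi.
set c := (\int[mu]_x phi x)%R.
have c0 : 0 <= c by exact: Rintegral_ge0.
have cE : (\int[mu]_x (phi x)%:E = c%:E)%E.
  by rewrite /c /Rintegral fineK//; exact: integrable_fin_num.
have : (\int[mu]_x ((2 * c) * phi x)%:E <= \int[mu]_x (phi x ^+ 2 + c ^+ 2)%:E)%E.
  apply: ge0_le_integral_EFin.
  - exact: measurable_funM.
  - by apply: measurable_funD => //; exact: measurable_funX.
  - by move=> x; rewrite !mulr_ge0.
  - by move=> x; have := sqr_ge0 (phi x - c); rewrite sqrrB; lra.
rewrite ge0_integralZ_EFin ?mulr_ge0// cE ge0_integralD_EFin ?integral_cst_EFin//; last 3 first.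
- exact: measurable_funX.
- by move=> x; exact: sqr_ge0.
- by move=> x; exact: sqr_ge0.
case: (\int[mu]_x _)%E => [r| |].
- by rewrite -EFinM -EFinD !lee_fin; lra.
- by move=> _; rewrite leey.
- by rewrite addNye -EFinM.
Qed.

Lemma integral_sqrt_le phi (B : R) : measurable_fun setT phi ->
  (forall x, 0 <= phi x) -> 0 <= B -> (\int[mu]_x (phi x)%:E <= B%:E)%E ->
  (\int[mu]_x (Num.sqrt (phi x))%:E <= (Num.sqrt B)%:E)%E.
Proof.
move=> mphi phi0 B0 hB.
have I2 : mu.-integrable setT (EFin \o (fun x => phi x)).
  apply/integrableP; split; first exact/measurable_EFinP.
  apply: le_lt_trans (ltry B); apply: le_trans hB.
  by rewrite le_eqVlt (eq_integral (fun x => (phi x)%:E)) ?eqxx// => x _ /=; rewrite ger0_norm.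
have Is : mu.-integrable setT (EFin \o (fun x => Num.sqrt (phi x))).
  (* A square root is at most its argument plus 1, whence the integrability. *)
  apply: (le_integrable measurableT (g := EFin \o (fun x => 1 * phi x + 1 * 1))) => //.
  - by apply/measurable_EFinP; exact: measurable_sqrt.
  - move=> x _ /=; rewrite lee_fin !mul1r !ger0_norm ?sqrtr_ge0 ?addr_ge0//.
    have := sqr_ge0 (Num.sqrt (phi x) - 1); have := sqrtr_ge0 (phi x).
    by rewrite sqrrB sqr_sqrtr//; lra.
  - by apply: (@integrableZD _ _ _ mu 1 1 phi (cst 1)) => //; exact: finite_measure_integrable_cst.
have := sqr_Rintegral_le Is (fun x => sqrtr_ge0 _).
under eq_integral do rewrite sqr_sqrtr//.
move=> /le_trans/(_ hB); rewrite lee_fin => h.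
rewrite -[X in (X <= _)%E]fineK; last exact: integrable_fin_num.
rewrite lee_fin -[fine _]ger0_norm; last by apply: Rintegral_ge0 => x _; exact: sqrtr_ge0.
by rewrite -sqrtr_sqr ler_wsqrtr.
Qed.

(** The absorption step. [C] only excludes [+oo] and is absent from the conclusion, so a bound as
    crude as the truncation level will do. *)
Lemma self_bound (e : \bar R) (A C : R) : (0 <= e)%E -> (e <= C%:E)%E ->
  (e <= A%:E + (2^-1)%:E * e)%E -> (e <= (2 * A)%:E)%E.
Proof.
case: e => [r _ _| |]//; rewrite -EFinM -EFinD !lee_fin; lra.
Qed.

End IntegralBounds.

Section Marginals.
Context (R : realType) (dW dS : measure_display) (W : measurableType dW)
  (S : measurableType dS) (P : probability W R) (n : nat) (X : 'I_n -> {RV P >-> S})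
  (mu : probability S R).
Hypothesis indepX : mutually_independent X.
Hypothesis lawX : forall i A, measurable A -> P (X i @^-1` A) = mu A.
Local Notation Ex := (mean X).
Implicit Types (phi psi : n.-tuple S -> R).

Lemma measurable_Ex (phi : n.-tuple S -> R) : measurable_fun [set: n.-tuple S] phi ->
  measurable_fun setT (fun w => phi (sample X w)).
Proof.
by move=> mphi; apply: (measurableT_comp mphi); exact: measurable_sample.
Qed.

Lemma Ex_ge0 phi : (forall x, 0 <= phi x) -> (0 <= Ex phi)%E.
Proof. by move=> phi0; apply: integral_ge0 => w _; rewrite lee_fin. Qed.

Lemma le_Ex phi psi : measurable_fun [set: n.-tuple S] phi ->
  measurable_fun [set: n.-tuple S] psi ->
  (forall x, 0 <= phi x) -> (forall x, phi x <= psi x) -> (Ex phi <= Ex psi)%E.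
Proof.
move=> mphi mpsi phi0 pp; apply: ge0_le_integral_EFin => //; exact: measurable_Ex.
Qed.

Lemma Ex_cst k : Ex (fun=> k) = k%:E.
Proof. exact: integral_cst_EFin. Qed.

Lemma Ex_le_cst phi k : measurable_fun [set: n.-tuple S] phi ->
  (forall x, 0 <= phi x) -> (forall x, phi x <= k) -> (Ex phi <= k%:E)%E.
Proof. by move=> mphi phi0 phik; rewrite -Ex_cst; exact: le_Ex. Qed.

Lemma ExD phi psi : measurable_fun [set: n.-tuple S] phi ->
  measurable_fun [set: n.-tuple S] psi ->
  (forall x, 0 <= phi x) -> (forall x, 0 <= psi x) ->
  (Ex (fun x => phi x + psi x)%R = Ex phi + Ex psi)%E.
Proof.
by move=> mphi mpsi phi0 psi0; apply: ge0_integralD_EFin => //; exact: measurable_Ex.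
Qed.

Lemma ExZ k phi : measurable_fun [set: n.-tuple S] phi ->
  (forall x, 0 <= phi x) -> 0 <= k -> (Ex (fun x => k * phi x)%R = k%:E * Ex phi)%E.
Proof.
by move=> mphi phi0 k0; apply: ge0_integralZ_EFin => //; exact: measurable_Ex.
Qed.

Lemma ExZ_le k phi e : measurable_fun [set: n.-tuple S] phi ->
  (forall x, 0 <= phi x) -> 0 <= k -> (Ex phi <= e)%E ->
  (Ex (fun x => k * phi x)%R <= k%:E * e)%E.
Proof. by move=> mphi phi0 k0 phie; rewrite ExZ// lee_wpmul2l// lee_fin. Qed.

(** Common shape of the two absorption arguments. The bounds are extended reals so that [e3] may be
    the very expectation under estimation. *)
Lemma Ex_le3 phi phi1 phi2 phi3 k0 k1 k2 k3 e1 e2 e3 :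
  measurable_fun [set: n.-tuple S] phi ->
  measurable_fun [set: n.-tuple S] phi1 ->
  measurable_fun [set: n.-tuple S] phi2 ->
  measurable_fun [set: n.-tuple S] phi3 ->
  (forall x, 0 <= phi x) -> (forall x, 0 <= phi1 x) ->
  (forall x, 0 <= phi2 x) -> (forall x, 0 <= phi3 x) ->
  0 <= k0 -> 0 <= k1 -> 0 <= k2 -> 0 <= k3 ->
  (forall x, phi x <= k0 + k1 * phi1 x + k2 * phi2 x + k3 * phi3 x) ->
  (Ex phi1 <= e1)%E -> (Ex phi2 <= e2)%E -> (Ex phi3 <= e3)%E ->
  (Ex phi <= k0%:E + k1%:E * e1 + k2%:E * e2 + k3%:E * e3)%E.
Proof.
move=> mphi m1 m2 m3 phi0 p1 p2 p3 k00 k10 k20 k30 phiD E1 E2 E3.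
have mZ k psi : measurable_fun [set: n.-tuple S] psi ->
    measurable_fun [set: n.-tuple S] (fun x => k * psi x).
  by move=> mpsi; exact: measurable_funM.
have Z0 k psi : 0 <= k -> (forall x, 0 <= psi x) -> forall x : n.-tuple S, 0 <= k * psi x.
  by move=> k_ge0 psi0 x; exact: mulr_ge0.
have mD1 : measurable_fun [set: n.-tuple S] (fun x => k0 + k1 * phi1 x).
  by apply: measurable_funD => //; exact: mZ.
have D1 x : 0 <= k0 + k1 * phi1 x by apply: addr_ge0 => //; exact: Z0.
have mD2 : measurable_fun [set: n.-tuple S] (fun x => k0 + k1 * phi1 x + k2 * phi2 x).
  by apply: measurable_funD => //; exact: mZ.
have D2 x : 0 <= k0 + k1 * phi1 x + k2 * phi2 x by apply: addr_ge0 => //; exact: Z0.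
apply: (le_trans (le_Ex mphi _ phi0 phiD)).
  by apply: measurable_funD => //; exact: mZ.
rewrite ExD//; [|exact: mZ|exact: Z0]; apply: leeD; last exact: ExZ_le.
rewrite ExD//; [|exact: mZ|exact: Z0]; apply: leeD; last exact: ExZ_le.
rewrite ExD//; [|exact: mZ|exact: Z0]; apply: leeD; last exact: ExZ_le.
by rewrite Ex_cst.
Qed.

Lemma Ex_sqrt_le phi (B : R) : measurable_fun [set: n.-tuple S] phi ->
  (forall x, 0 <= phi x) -> 0 <= B -> (Ex phi <= B%:E)%E ->
  (Ex (fun x => Num.sqrt (phi x)) <= (Num.sqrt B)%:E)%E.
Proof.
by move=> mphi phi0 B0 hB; apply: integral_sqrt_le => //; exact: measurable_Ex.
Qed.

(** Resampling [j] and then [i] leaves an integrand that no longer depends on the sample. *)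
Lemma integral_pair i j (psi : S * S -> R) : i != j -> measurable_fun setT psi ->
  (forall z, 0 <= psi z) ->
  (Ex (fun x => psi (tnth x i, tnth x j)) = \int[mu]_x \int[mu]_y (psi (x, y))%:E)%E.
Proof.
move=> ij mpsi psi0.
pose G x := (\int[mu]_y (psi (x, y))%:E)%E.
have mG : measurable_fun setT G.
  apply: (measurable_fun_fubini_tonelli_F (fun z => (psi z)%:E)) => //.
  exact/measurable_EFinP.
have G0 x : (0 <= G x)%E by apply: integral_ge0 => y _; rewrite lee_fin.
have mt k : measurable_fun [set: n.-tuple S] (fun x => tnth x k) by exact: measurable_tnth.
rewrite /Ex.
rewrite (resampling indepX lawX j
  (phi := fun x => (psi (tnth x i, tnth x j))%:E)); last 2 first.
- apply/measurable_EFinP; apply: measurableT_comp => //.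
  exact: measurable_fun_pair.
- by move=> x; rewrite lee_fin.
transitivity (\int[P]_w G (tnth (sample X w) i))%E.
  apply: eq_integral => w _; apply: eq_integral => z _.
  by rewrite !tnth_upd eqxx (negbTE ij).
rewrite (resampling indepX lawX i (phi := fun x => G (tnth x i)))//; last exact: measurableT_comp (mt i).
transitivity (\int[P]_w (cst (\int[mu]_x G x) w))%E.
  apply: eq_integral => w _; apply: eq_integral => z _.
  by rewrite tnth_upd eqxx.
rewrite integral_cst//; set I := (\int[mu]_x G x)%E.
by rewrite [X in (_ * X)%E](_ : _ = 1%E) ?mule1//; exact: probability_setT.
Qed.

End Marginals.

(** * Nonnegative bounded kernels: absorption *)

Section BoundedKernel.
Context (R : realType) (dW dS : measure_display) (W : measurableType dW)
  (S : measurableType dS) (P : probability W R) (n : nat) (X : 'I_n -> {RV P >-> S})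
  (mu : probability S R).
Hypothesis indepX : mutually_independent X.
Hypothesis lawX : forall i A, measurable A -> P (X i @^-1` A) = mu A.
Local Notation Ex := (mean X).
Context (d : nat).
Hypothesis d0 : (0 < d)%N.
Local Notation L := (ln (2 * d%:R) : R).

(** In the application [h] is min (f^2, N), [C] is N and [M2] is M^2, while [a], [b], [c] are D_2^2,
    D_4^4 and the fourth power of the norm of M. [C] provides integrability and finiteness and must
    not enter the bounds. *)
Variables (h : 'I_d -> S -> S -> R) (C : R).
Hypothesis hsym : forall m x y, h m x y = h m y x.
Hypothesis mh : forall m, measurable_fun [set: S * S] (fun z => h m z.1 z.2).
Hypothesis hC : forall m x y, 0 <= h m x y <= C.
Variables (i0 i1 : 'I_n) (i01 : i0 != i1).
Variable M2 : n.-tuple S -> R.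
Hypothesis mM2 : measurable_fun [set: n.-tuple S] M2.
Hypothesis M2_ge0 : forall x, 0 <= M2 x.
Hypothesis hM2 : forall x i j m, i != j -> h m (tnth x i) (tnth x j) <= M2 x.
Variables (a b c : R).
Hypotheses (a0 : 0 <= a) (b0 : 0 <= b) (c0 : 0 <= c).
Hypothesis ha : forall m, (Ex (fun x => h m (tnth x i0) (tnth x i1)) <= a%:E)%E.
Hypothesis hb : forall m, (Ex (fun x => h m (tnth x i0) (tnth x i1) ^+ 2)%R <= b%:E)%E.
Hypothesis hc : (Ex (fun x => M2 x ^+ 2)%R <= c%:E)%E.

Let h0 m x y : 0 <= h m x y. Proof. by have /andP[] := hC m x y. Qed.

Let mh1 m x : measurable_fun setT (h m x).
Proof.
apply: (measurableT_comp (f := fun z : S * S => h m z.1 z.2) (g := fun y => (x, y))) => //.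
by apply: measurable_fun_pair; [exact: measurable_cst|exact: measurable_id].
Qed.

Let Ih m x : mu.-integrable setT (EFin \o h m x).
Proof. by apply: (@integrable_bounded _ _ _ _ _ C). Qed.

Local Notation g := (proj1 mu h).

Let gC m x : 0 <= g m x <= C.
Proof.
rewrite Rintegral_ge0/=; last by move=> y _; exact: h0.
apply: ge0_EFin_Rintegral_le => //; rewrite -(integral_cst_EFin mu).
apply: ge0_le_integral_EFin => // y; by have /andP[] := hC m x y.
Qed.

Let g0 m x : 0 <= g m x. Proof. by have /andP[] := gC m x. Qed.

Let mg m : measurable_fun setT (g m).
Proof.
apply: (measurableT_comp (f := fine)
  (g := fun x => (\int[mu]_y (h m x y)%:E)%E)); first exact: fine_measurable.
apply: (measurable_fun_fubini_tonelli_F (fun z => (h m z.1 z.2)%:E)) => [|z].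
  exact/measurable_EFinP.
by rewrite lee_fin.
Qed.

Let Ig m : mu.-integrable setT (EFin \o g m).
Proof. by apply: (@integrable_bounded _ _ _ _ _ C). Qed.

Let gE m x : ((g m x)%:E = \int[mu]_y (h m x y)%:E)%E.
Proof. by rewrite /proj1 /Rintegral fineK//; exact: (integrable_fin_num measurableT (Ih m x)). Qed.

Let mgt m i : measurable_fun [set: n.-tuple S] (fun x => g m (tnth x i)).
Proof. by apply: (measurableT_comp (mg m)); exact: measurable_tnth. Qed.

Let theta_le m : 0 <= proj0 mu h m <= a.
Proof.
rewrite Rintegral_ge0//=; apply: ge0_EFin_Rintegral_le => //.
under eq_integral do rewrite gE.
by have := ha m; rewrite (integral_pair indepX lawX i01 (psi := fun z => h m z.1 z.2)).
Qed.

(** Conditional Jensen: E g^2 <= E h^2. This is how D_4 enters. *)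
Let g2_le m : 0 <= \int[mu]_x (g m x ^+ 2) <= b.
Proof.
rewrite Rintegral_ge0/=; last by move=> x _; exact: sqr_ge0.
apply: ge0_EFin_Rintegral_le => [x|]; first exact: sqr_ge0.
have := hb m; rewrite (integral_pair indepX lawX i01 (psi := fun z => h m z.1 z.2 ^+ 2)).
- apply: le_trans; apply: ge0_le_integral => //.
  + by move=> x _; rewrite lee_fin sqr_ge0.
  + by apply/measurable_EFinP; exact: measurable_funX.
  + apply: (measurable_fun_fubini_tonelli_F (fun z => (h m z.1 z.2 ^+ 2)%:E)) => [|z].
      by apply/measurable_EFinP; exact: measurable_funX.
    by rewrite lee_fin sqr_ge0.
  + by move=> x _; exact: sqr_Rintegral_le.
- exact: measurable_funX.
- by move=> z; exact: sqr_ge0.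
Qed.

(* For [i != k], [g m (x_i)^2] is at most the conditional expectation of [M2^2]
   given the coordinates other than [k]. *)
Let proj1_max_le (k : 'I_n) :
  (Ex (fun x => \big[Num.max/0]_(i < n | i != k) nrm (fun m => g m (tnth x i) ^+ 2))%R
   <= c%:E)%E.
Proof.
pose G (x : n.-tuple S) := \big[Num.max/0]_(i < n | i != k) nrm (fun m => g m (tnth x i) ^+ 2).
have mG : measurable_fun [set: n.-tuple S] G.
  apply: measurable_bigmax => i; apply: measurable_nrm => m.
  exact: measurable_funX.
apply: le_trans hc.
apply: (le_resampling indepX lawX (i := k) (phi := EFin \o G)
  (psi := fun x => (M2 x ^+ 2)%:E)) => [| | | |x].
- exact/measurable_EFinP.
- by apply/measurable_EFinP; exact: measurable_funX.
- by move=> x; rewrite lee_fin; exact: bigmax_ge_id.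
- by move=> x; rewrite lee_fin sqr_ge0.
have mMk : measurable_fun setT (fun z => M2 (upd x k z)).
  exact: (measurableT_comp mM2 (measurable_upd_coord x k)).
set I := (\int[mu]_z (M2 (upd x k z) ^+ 2)%:E)%E.
have I0 : (0 <= I)%E by apply: integral_ge0 => z _; rewrite lee_fin sqr_ge0.
have GI : ((G x)%:E <= I)%E.
  rewrite /G; elim/big_ind: _ => // [u v uI vI|i ik]; first by rewrite EFin_max ge_max uI vI.
  apply: EFin_nrm_le => // m; rewrite ger0_norm ?sqr_ge0//.
  apply: (le_trans (sqr_Rintegral_le (Ih m (tnth x i)) (h0 m (tnth x i)))).
  apply: ge0_le_integral_EFin => [||z|z].
  - exact: measurable_funX.
  - exact: measurable_funX.
  - exact: sqr_ge0.
  - rewrite ler_pXn2r ?nnegrE//; have := hM2 (upd x k z) m ik.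
    by rewrite !tnth_upd eqxx (negbTE ik).
rewrite (_ : (\int[mu]_z _)%E = (\int[mu]_z (G x)%:E)%E); last first.
  apply: eq_integral => z _ /=; congr EFin; apply: eq_bigr => i ik.
  by rewrite tnth_upd (negbTE ik).
by rewrite integral_cst_EFin.
Qed.

(** [proj1_max_le] always leaves out one index. Leaving out [i0] and then [i1] covers every index,
    at the price of doubling [c]. *)
Let proj1_dominated : exists G2 : n.-tuple S -> R,
  [/\ measurable_fun [set: n.-tuple S] G2, forall x, 0 <= G2 x,
      forall x m i, g m (tnth x i) ^+ 2 <= G2 x & (Ex G2 <= (2 * c)%:E)%E].
Proof.
pose G (k : 'I_n) (x : n.-tuple S) :=
  \big[Num.max/0]_(i < n | i != k) nrm (fun m => g m (tnth x i) ^+ 2).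
have mG k : measurable_fun [set: n.-tuple S] (G k).
  apply: measurable_bigmax => i; apply: measurable_nrm => m.
  exact: measurable_funX.
have G0 k x : 0 <= G k x by exact: bigmax_ge_id.
have gG k m x i : i != k -> g m (tnth x i) ^+ 2 <= G k x.
  move=> ik; apply: (@le_trans _ _ (nrm (fun m => g m (tnth x i) ^+ 2))).
    by apply: le_trans (le_nrm _ m); exact: ler_norm.
  exact: (le_bigmax_cond _ (fun i => nrm (fun m => g m (tnth x i) ^+ 2))).
exists (fun x => G i0 x + G i1 x); split.
- exact: measurable_funD.
- by move=> x; rewrite addr_ge0.
- move=> x m i; have [->|ii0] := eqVneq i i0.
    by rewrite (le_trans (gG i1 m x _ i01))// lerDr.
  by rewrite (le_trans (gG i0 m x _ ii0))// lerDl.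
- rewrite ExD// (_ : 2 * c = c + c); last by ring.
  by rewrite EFinD; apply: leeD; exact: proj1_max_le.
Qed.

Let Y (x : n.-tuple S) := nrm (fun m => \sum_i g m (tnth x i) ^+ 2).

Let mY : measurable_fun [set: n.-tuple S] Y.
Proof.
by apply: measurable_nrm => m; apply: measurable_sum => i; exact: measurable_funX.
Qed.

Let L0 : 0 <= L. Proof. exact: ltW (ln2d_gt0 _ d0). Qed.

(** The squares g^2 are symmetrised in their turn. Their signed sum has coefficients of squared norm
    at most [G2 * Y], so the root of [Y] that appears on the right can be absorbed. *)
Let Y_le : (Ex Y <= (2 * (n%:R * b) + 128 * L * c)%:E)%E.
Proof.
have [G2 [mG2 G20 gG2 EG2]] := proj1_dominated.
rewrite (_ : 2 * (n%:R * b) + _ = 2 * (n%:R * b + 32 * L * (2 * c))); last by ring.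
have Y0 x : 0 <= Y x by exact: nrm_ge0.
apply: (@self_bound _ _ _ (n%:R * C ^+ 2)); first exact: Ex_ge0.
  apply: Ex_le_cst => // x; apply: nrm_le.
    by rewrite mulr_ge0// sqr_ge0.
  move=> m; rewrite ger0_norm; last by apply: sumr_ge0 => i _; exact: sqr_ge0.
  rewrite (_ : n%:R * _ = \sum_(i < n) C ^+ 2); last by rewrite sumr_const card_ord mulr_natl.
  apply: ler_sum => i _.
  by have /andP[? ?] := gC m (tnth x i); rewrite ler_pXn2r ?nnegrE// (le_trans (g0 m (tnth x i))).
have Ig2 m : mu.-integrable setT (EFin \o (fun z => g m z ^+ 2)).
  apply: (@integrable_bounded _ _ _ _ _ (C ^+ 2)); first exact: measurable_funX.
  move=> x; have /andP[? gx] := gC m x.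
  by rewrite sqr_ge0/= ler_pXn2r ?nnegrE// (le_trans (g0 m x)).
apply: (le_trans (sum_symmetrization indepX lawX Ig2)).
have k0 : 0 <= n%:R * b by exact: mulr_ge0.
have k1 : 0 <= 32 * L by exact: mulr_ge0.
rewrite (_ : (n%:R * b + _)%:E =
    (n%:R * b)%:E + (32 * L)%:E * (2 * c)%:E + 0%:E * 0)%E; last first.
  by rewrite mul0e adde0 EFinD EFinM.
apply: (Ex_le3 (phi1 := G2) (phi2 := fun=> 0) (phi3 := Y)) => //; last by rewrite Ex_cst.
- apply: measurable_avg => e; apply: measurable_nrm => m; apply: measurable_sum => i.
  by apply: measurable_funD => //; apply: measurable_funM => //; exact: measurable_funX.
- by move=> x; apply: avg_ge0 => e; exact: nrm_ge0.
- move=> x; rewrite mul0r addr0.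
have Ysum m : \sum_i (g m (tnth x i) ^+ 2) ^+ 2 <= G2 x * Y x.
  apply: (@le_trans _ _ (G2 x * \sum_i g m (tnth x i) ^+ 2)).
    rewrite mulr_sumr; apply: ler_sum => i _.
    by rewrite [leLHS]expr2 ler_wpM2r// sqr_ge0.
  rewrite ler_wpM2l//; apply: le_trans (le_nrm _ m); exact: ler_norm.
have lin := avg_nrm_le d0 (mulr_ge0 (G20 x) (Y0 x)) Ysum.
apply: (@le_trans _ _ (n%:R * b + 2 * Num.sqrt (16 * L * (G2 x * Y x)))).
  apply: (@le_trans _ _ (avg (fun e : {ffun 'I_n -> bool} => n%:R * b +
      2 * nrm (fun m => \sum_i sg e i * g m (tnth x i) ^+ 2)))).
    apply: le_avg => e.
    under [X in nrm X]eq_fun do rewrite big_split/=.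
    apply: (le_trans (nrmD _ _)); apply: lerD.
      apply: nrm_le => [|m]; first by rewrite mulr_ge0.
      rewrite sumr_const card_ord normrMn -[leLHS]mulr_natl ler_wpM2l//.
      by have /andP[? ?] := g2_le m; rewrite ger0_norm.
    rewrite -[X in X * nrm _](ger0_norm (ler0n _ 2)) -nrmZ.
    apply: le_nrm2 => m; rewrite mulr_sumr.
    by under eq_bigr do rewrite -mulrA.
  by rewrite avgD avg_cst avgZ lerD2l ler_pM2l.
rewrite -addrA lerD2l.
have -> : 16 * L * (G2 x * Y x) = (16 * L * G2 x) * Y x by ring.
rewrite sqrtrM; last by rewrite !mulr_ge0.
(* 2uv <= 2u^2 + v^2/2, weighted to leave exactly half of [Y]; u^2 is [16 * L * G2 x], whence
   [32 * L]. *)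
have := sqr_ge0 (2 * Num.sqrt (16 * L * G2 x) - Num.sqrt (Y x)).
have s1 := sqr_sqrtr (Y0 x).
have s2 : Num.sqrt (16 * L * G2 x) ^+ 2 = 16 * L * G2 x by rewrite sqr_sqrtr// !mulr_ge0.
move: (Num.sqrt _) (Num.sqrt _) s1 s2 => u v uu vv; nra.
Qed.

(** Given the sample, this is a Rademacher sum with coefficients of squared norm at most [Y]; Jensen
    for the root then allows [Y_le]. *)
Let lin_le : (Ex (fun x => avg (fun e => nrm (fun m => \sum_i sg e i * g m (tnth x i))))%R <=
  (Num.sqrt (16 * L * (2 * (n%:R * b) + 128 * L * c)))%:E)%E.
Proof.
have Y0 x : 0 <= Y x by exact: nrm_ge0.
apply: (@le_trans _ _ (Ex (fun x => Num.sqrt (16 * L * Y x)))).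
  apply: le_Ex.
  - apply: measurable_avg => e; apply: measurable_nrm => m; apply: measurable_sum => i.
    exact: measurable_funM.
  - by apply: measurable_sqrt; exact: measurable_funM.
  - by move=> x; apply: avg_ge0 => e; exact: nrm_ge0.
  - move=> x; apply: avg_nrm_le => // m.
    by apply: le_trans (le_nrm _ m); exact: ler_norm.
apply: Ex_sqrt_le.
- exact: measurable_funM.
- by move=> x; rewrite !mulr_ge0.
- by rewrite !mulr_ge0// addr_ge0// !mulr_ge0.
- by rewrite (EFinM (16 * L)); apply: ExZ_le => //; exact: mulr_ge0.
Qed.

(** The three terms are the mean, the linear part and the price of absorbing the chaos, all doubled
    by [self_bound]. The chaos has coefficients with h^2 <= M2 h off the diagonal, so its size is
    governed by the root of [M2 * Z]. *)
Lemma bounded_kernel_maximal :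
  (Ex (fun x => nrm (fun m => \sum_i \sum_(j | i != j) h m (tnth x i) (tnth x j)))%R <=
   (2 * n%:R ^+ 2 * a + 8 * n%:R * Num.sqrt (16 * L * (2 * (n%:R * b) + 128 * L * c)) +
    (256 * L) ^+ 2 * Num.sqrt c)%:E)%E.
Proof.
pose Z (x : n.-tuple S) := nrm (fun m => \sum_i \sum_(j | i != j) h m (tnth x i) (tnth x j)).
rewrite -/Z; have Z0 x : 0 <= Z x by exact: nrm_ge0.
set lin := Num.sqrt (16 * L * _).
rewrite (_ : _ + _ = 2 * (n%:R ^+ 2 * a + 4 * n%:R * lin + 2^-1 * (256 * L) ^+ 2 * Num.sqrt c));
  last by field.
have mZ : measurable_fun [set: n.-tuple S] Z.
  apply: measurable_nrm => m; apply: measurable_sum => i.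
  under eq_fun do rewrite big_mkcond; apply: measurable_sum => j.
  by case: (i != j) => //; exact: measurable_pair.
have sum_pairs (k : R) : 0 <= k -> \sum_(i < n) \sum_(j < n | i != j) k <= n%:R ^+ 2 * k.
  move=> k0; apply: (@le_trans _ _ (\sum_(i < n) \sum_(j < n) k)).
    apply: ler_sum => i _; rewrite big_mkcond/=; apply: ler_sum => j _.
    by case: ifP.
  by rewrite !sumr_const !card_ord -mulrnA -[k *+ _]mulr_natl natrM.
apply: (@self_bound _ _ _ (n%:R ^+ 2 * C)); first exact: Ex_ge0.
  apply: Ex_le_cst => // x.
  have C0 : 0 <= C.
    have := hC (Ordinal d0) (tnth x i0) (tnth x i0); move=> /andP[u v]; exact: le_trans u v.
  apply: nrm_le => [|m]; first by rewrite mulr_ge0// sqr_ge0.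
  rewrite ger0_norm; last by do 2 apply: sumr_ge0 => ? _.
  apply: le_trans (sum_pairs _ C0); apply: ler_sum => i _; apply: ler_sum => j _.
  by have /andP[] := hC m (tnth x i) (tnth x j).
apply: (le_trans (pair_symmetrization indepX lawX hsym mh Ih Ig)).
pose l (x : n.-tuple S) :=
  avg (fun e : {ffun 'I_n -> bool} => nrm (fun m => \sum_i sg e i * g m (tnth x i))).
have ml : measurable_fun [set: n.-tuple S] l.
  apply: measurable_avg => e; apply: measurable_nrm => m; apply: measurable_sum => i.
  exact: measurable_funM.
have l0 x : 0 <= l x by apply: avg_ge0 => e; exact: nrm_ge0.
have EM2 : (Ex M2 <= (Num.sqrt c)%:E)%E.
  rewrite (_ : Ex M2 = Ex (fun x => Num.sqrt (M2 x ^+ 2))).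
    apply: Ex_sqrt_le => //; first exact: measurable_funX.
    by move=> x; exact: sqr_ge0.
  by congr (mean X); apply/funext => x; rewrite sqrtr_sqr ger0_norm.
have q0 : 0 <= 2^-1 * (256 * L) ^+ 2 by rewrite mulr_ge0// sqr_ge0.
have n0 : 0 <= 4 * n%:R :> R by rewrite mulr_ge0.
have n2a : 0 <= n%:R ^+ 2 * a by rewrite mulr_ge0// sqr_ge0.
set q := 2^-1 * (256 * L) ^+ 2 in q0 *.
have El : (Ex l <= lin%:E)%E by exact: lin_le.
rewrite !EFinD (EFinM q) (EFinM (4 * n%:R)).
apply: (Ex_le3 (phi1 := l) (phi2 := M2) (phi3 := Z)) => //.
- apply: measurable_avg => e; apply: measurable_nrm => m; apply: measurable_sum => i.
  under eq_fun do rewrite big_mkcond; apply: measurable_sum => j.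
  case: (i != j) => //.
  apply: measurable_funD => //; apply: measurable_funD; last exact: measurable_funM.
  apply: measurable_funD; last exact: measurable_funM.
  apply: measurable_funM => //; apply: measurable_funM => //; exact: measurable_pair.
- by move=> x; apply: avg_ge0 => e; exact: nrm_ge0.
move=> x.
pose ch (e : {ffun 'I_n -> bool}) m :=
  \sum_i \sum_(j | i != j) sg e i * sg e j * h m (tnth x i) (tnth x j).
have chaos : avg (fun e => nrm (ch e)) <= 64 * L * Num.sqrt (M2 x * Z x).
  apply: avg_nrm_chaos_le => // [|m]; first by rewrite mulr_ge0.
  apply: (@le_trans _ _ (M2 x * \sum_i \sum_(j | i != j) h m (tnth x i) (tnth x j))).
    rewrite mulr_sumr; apply: ler_sum => i _; rewrite mulr_sumr; apply: ler_sum => j ij.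
    by rewrite expr2 ler_wpM2r// hM2.
  by rewrite ler_wpM2l//; apply: le_trans (le_nrm _ m); exact: ler_norm.
apply: (@le_trans _ _ (avg (fun e => 4 * nrm (ch e) +
    (4 * n%:R * nrm (fun m => \sum_i sg e i * g m (tnth x i)) + n%:R ^+ 2 * a)))).
  apply: le_avg => e; apply: nrm_le.
    by rewrite !addr_ge0// mulr_ge0 ?nrm_ge0// sqr_ge0.
  move=> m.
  (* Each e_i occurs in n - 1 pairs (i, j) and in n - 1 pairs (j, i), with coefficient 2. The
     resulting 4 (n - 1) is later rounded up to 4 n. *)
  have -> : \sum_i \sum_(j | i != j)
     (4 * (sg e i * sg e j * h m (tnth x i) (tnth x j)) +
      2 * sg e i * g m (tnth x i) + 2 * sg e j * g m (tnth x j) + proj0 mu h m) =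
      4 * ch e m + (4 * (n%:R - 1) * (\sum_i sg e i * g m (tnth x i)) +
      \sum_(i < n) \sum_(j < n | i != j) proj0 mu h m).
    have row (v : 'I_n -> R) : \sum_(i < n) \sum_(j | i != j) 2 * v i =
        2 * (n%:R - 1) * \sum_i v i.
      rewrite mulr_sumr; apply: eq_bigr => i _; rewrite sumr_const.
      rewrite (_ : #|_| = n.-1); last first.
        rewrite -[in RHS](card_ord n) -(cardC1 i); apply: eq_card => j.
        by rewrite !inE eq_sym.
      rewrite -[LHS]mulr_natl -subn1 natrB; last exact: leq_ltn_trans (ltn_ord i).
      ring.
    have -> : 4 * (n%:R - 1) * (\sum_i sg e i * g m (tnth x i)) =
       \sum_(i < n) \sum_(j | i != j) 2 * (sg e i * g m (tnth x i)) +
       \sum_(i < n) \sum_(j | i != j) 2 * (sg e j * g m (tnth x j)).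
      rewrite row [X in _ = _ + X](exchange_big_dep xpredT)//=.
      under [X in _ = _ + X]eq_bigr do under eq_bigl do rewrite eq_sym.
      by rewrite row; ring.
    rewrite /ch mulr_sumr -!big_split/=; apply: eq_bigr => i _.
    by rewrite mulr_sumr -!big_split/=; apply: eq_bigr => j _; ring.
  rewrite (le_trans (ler_normD _ _))//; apply: lerD.
    by rewrite normrM ger0_norm// ler_pM2l// le_nrm.
  rewrite (le_trans (ler_normD _ _))//; apply: lerD.
    rewrite normrM; apply: ler_pM => //; last first.
      exact: (le_nrm (fun m => \sum_i sg e i * g m (tnth x i))).
    have n1 : 1 <= n%:R :> R by rewrite ler1n; exact: leq_ltn_trans (ltn_ord i0).
    by rewrite ger0_norm; lra.
  have /andP[t0 ta] := theta_le m.
  rewrite ger0_norm; last by do 2 apply: sumr_ge0 => ? _.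
  apply: le_trans (sum_pairs _ a0); do 2 apply: ler_sum => ? _; exact: ta.
rewrite avgD avgZ avgD avgZ avg_cst -/(l x).
(* 256 L u v <= ((256 L u)^2 + v^2)/2 with u, v the roots of [M2 x] and [Z x]: half of [Z] goes to
   the left-hand side. *)
have key : 4 * avg (fun e => nrm (ch e)) <= q * M2 x + 2^-1 * Z x.
  apply: (@le_trans _ _ (4 * (64 * L * Num.sqrt (M2 x * Z x)))); first by rewrite ler_pM2l.
  rewrite /q sqrtrM//; have s1 := sqr_sqrtr (Z0 x); have s2 := sqr_sqrtr (M2_ge0 x).
  have := sqr_ge0 (256 * L * Num.sqrt (M2 x) - Num.sqrt (Z x)).
  by move: (Num.sqrt (M2 x)) (Num.sqrt (Z x)) s1 s2 => u v <- <-; nra.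
move: key; lra.
Qed.

End BoundedKernel.

Ltac nonneg := repeat first [ exact: ler0n | exact: sqrtr_ge0 | assumption | apply: mulr_ge0
  | apply: addr_ge0 | apply: exprn_ge0 ].

(** * From the square function to canonical kernels *)

Section CanonicalKernel.
Context (R : realType) (dW dS : measure_display) (W : measurableType dW)
  (S : measurableType dS) (P : probability W R) (n : nat) (X : 'I_n -> {RV P >-> S})
  (mu : probability S R).
Hypothesis indepX : mutually_independent X.
Hypothesis lawX : forall i A, measurable A -> P (X i @^-1` A) = mu A.
Local Notation Ex := (mean X).
Context (d : nat).
Hypothesis d0 : (0 < d)%N.
Local Notation L := (ln (2 * d%:R) : R).

Variables (f : 'I_d -> S -> S -> R).
Hypothesis fsym : forall m x y, f m x y = f m y x.
Hypothesis mf : forall m, measurable_fun [set: S * S] (fun z => f m z.1 z.2).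
Variables (i0 i1 : 'I_n) (i01 : i0 != i1).
Variable M : n.-tuple S -> R.
Hypothesis mM : measurable_fun [set: n.-tuple S] M.
Hypothesis fM : forall x i j m, i != j -> `|f m (tnth x i) (tnth x j)| <= M x.
Variables (a b c : R).
Hypotheses (a0 : 0 <= a) (b0 : 0 <= b) (c0 : 0 <= c).
Hypothesis fa : forall m, (Ex (fun x => f m (tnth x i0) (tnth x i1) ^+ 2)%R <= a%:E)%E.
Hypothesis fb : forall m, (Ex (fun x => f m (tnth x i0) (tnth x i1) ^+ 4)%R <= b%:E)%E.
Hypothesis Mc : (Ex (fun x => M x ^+ 4)%R <= c%:E)%E.

Let B := 2 * n%:R ^+ 2 * a + 8 * n%:R * Num.sqrt (16 * L * (2 * (n%:R * b) + 128 * L * c)) +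
    (256 * L) ^+ 2 * Num.sqrt c.

Let mft m i j : measurable_fun [set: n.-tuple S] (fun x => f m (tnth x i) (tnth x j)).
Proof. exact: measurable_pair. Qed.

Let f2M x i j m : i != j -> f m (tnth x i) (tnth x j) ^+ 2 <= M x ^+ 2.
Proof.
move=> ij; rewrite -real_normK ?num_real// ler_pXn2r ?nnegrE ?fM//.
exact: le_trans (fM x m ij).
Qed.

(** Truncation only decreases f^2, so the moment bounds [a], [b], [c] hold for every level and [B]
    does not depend on [N]. *)
Lemma truncated_square_maximal (N : nat) :
  (Ex (fun x => nrm (fun m => \sum_i \sum_(j | i != j)
    Num.min (f m (tnth x i) (tnth x j) ^+ 2) N%:R))%R <= B%:E)%E.
Proof.
pose h m x y := Num.min (f m x y ^+ 2) N%:R.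
have h0 m x y : 0 <= h m x y by rewrite le_min sqr_ge0/=.
have hf m x y : h m x y <= f m x y ^+ 2 by rewrite ge_min lexx.
have mh m : measurable_fun [set: S * S] (fun z => h m z.1 z.2).
  by apply: measurable_minr => //; exact: measurable_funX.
have mht m : measurable_fun [set: n.-tuple S] (fun x => h m (tnth x i0) (tnth x i1)).
  exact: measurable_pair.
apply: (@bounded_kernel_maximal _ _ _ _ _ P n X mu indepX lawX d d0 h N%:R _ mh _ i0 i1 i01
  (fun x => M x ^+ 2)) => //.
- by move=> m x y; rewrite /h fsym.
- by move=> m x y; rewrite h0/= ge_min lexx orbT.
- exact: measurable_funX.
- by move=> x; exact: sqr_ge0.
- by move=> x i j m ij; apply: le_trans (hf _ _ _) (f2M _ _ ij).
- move=> m; apply: le_trans (fa m); apply: le_Ex => //; exact: measurable_funX.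
- move=> m; apply: le_trans (fb m); apply: le_Ex => //.
  + exact: measurable_funX.
  + exact: measurable_funX.
  + by move=> x; exact: sqr_ge0.
  + move=> x; rewrite (_ : 4 = 2 * 2)%N// exprM ler_pXn2r ?nnegrE//.
    exact: sqr_ge0.
- under [X in (mean _ X <= _)%E]eq_fun do rewrite -exprM.
  exact: Mc.
Qed.

(** Monotone convergence in [N]: at a given sample the truncation has no effect once N >= M^2, so
    the sequence is eventually constant. *)
Lemma square_maximal :
  (Ex (fun x => nrm (fun m => \sum_i \sum_(j | i != j)
    f m (tnth x i) (tnth x j) ^+ 2))%R <= B%:E)%E.
Proof.
pose u (N : nat) (x : n.-tuple S) := nrm (fun m => \sum_i \sum_(j | i != j)
    Num.min (f m (tnth x i) (tnth x j) ^+ 2) N%:R).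
have mu_ N : measurable_fun [set: n.-tuple S] (u N).
  apply: measurable_nrm => m; apply: measurable_sum => i.
  under eq_fun do rewrite big_mkcond; apply: measurable_sum => j.
  case: (i != j) => //.
  by apply: measurable_minr => //; exact: measurable_funX.
have limu x : limn (fun N => (u N x)%:E) = (nrm (fun m => \sum_i \sum_(j | i != j)
    f m (tnth x i) (tnth x j) ^+ 2))%:E.
  apply/cvg_lim => //; apply: cvg_near_cst.
  near=> N; congr EFin; congr nrm; apply/funext => m.
  apply: eq_bigr => i _; apply: eq_bigr => j ij; apply/min_idPl.
  apply: (le_trans (f2M x m ij)).
  by near: N; exact: nbhs_infty_ger.
have undecr x : {homo (fun N => (u N x)%:E) : N N' / (N <= N')%N >-> (N <= N')%E}.
  move=> N N' NN'; rewrite lee_fin; apply: le_nrm2 => m.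
  have min0 (k : nat) i j : 0 <= Num.min (f m (tnth x i) (tnth x j) ^+ 2) k%:R.
    by rewrite le_min sqr_ge0/=.
  rewrite !ger0_norm; [|by do 2 apply: sumr_ge0 => ? _..].
  apply: ler_sum => i _; apply: ler_sum => j _.
  by rewrite le_min2// ler_nat.
rewrite /Ex; under eq_integral do rewrite -limu.
rewrite monotone_convergence//; last 2 first.
- by move=> N; apply/measurable_EFinP; apply: measurable_Ex.
- by move=> N w _; rewrite lee_fin nrm_ge0.
apply: lime_le.
  apply: ereal_nondecreasing_is_cvgn => N N' NN'; apply: ge0_le_integral => //.
  - by move=> w _; rewrite lee_fin nrm_ge0.
  - by apply/measurable_EFinP; apply: measurable_Ex.
  - by apply/measurable_EFinP; apply: measurable_Ex.
  - by move=> w _; exact: undecr.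
by apply: nearW => N; exact: truncated_square_maximal.
Unshelve. all: by end_near. Qed.

Hypothesis f_canonical : forall m x,
  mu.-integrable setT (EFin \o f m x) /\ \int[mu]_y f m x y = 0.

Let B_ge0 : 0 <= B.
Proof.
have L0 : 0 <= L by exact: ltW (ln2d_gt0 _ d0).
by rewrite /B; nonneg.
Qed.

(** Both projections of a canonical kernel vanish, so symmetrisation leaves 4 times the chaos, and 4
    * 64 = 256. Jensen for the root then brings in [square_maximal]. *)
Lemma canonical_kernel_maximal :
  (Ex (fun x => nrm (fun m => \sum_i \sum_(j | i != j)
    f m (tnth x i) (tnth x j)))%R <= (256 * L * Num.sqrt B)%:E)%E.
Proof.
have L0 : 0 <= L by exact: ltW (ln2d_gt0 _ d0).
have g0 m : proj1 mu f m = fun=> 0 by apply/funext => x; have [] := f_canonical m x.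
have Ig m : mu.-integrable setT (EFin \o proj1 mu f m).
  by rewrite g0; exact: (finite_measure_integrable_cst mu 0).
have th0 m : proj0 mu f m = 0 by rewrite /proj0 g0 Rintegral_cst// mul0r.
have If m x : mu.-integrable setT (EFin \o f m x) by have [] := f_canonical m x.
apply: (le_trans (pair_symmetrization indepX lawX fsym mf If Ig)).
pose Z (x : n.-tuple S) := nrm (fun m => \sum_i \sum_(j | i != j)
    f m (tnth x i) (tnth x j) ^+ 2).
have mZ : measurable_fun [set: n.-tuple S] Z.
  apply: measurable_nrm => m; apply: measurable_sum => i.
  under eq_fun do rewrite big_mkcond; apply: measurable_sum => j.
  by case: (i != j) => //; exact: measurable_funX.
have Z0 x : 0 <= Z x by exact: nrm_ge0.
apply: (@le_trans _ _ (Ex (fun x => (256 * L) * Num.sqrt (Z x))%R)).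
  apply: le_Ex.
  - apply: measurable_avg => e; apply: measurable_nrm => m; apply: measurable_sum => i.
    under eq_fun do rewrite big_mkcond; apply: measurable_sum => j.
    case: (i != j) => //; rewrite g0.
    apply: measurable_funD => //; apply: measurable_funD; last exact: measurable_cst.
    apply: measurable_funD; last exact: measurable_cst.
    by apply: measurable_funM => //; apply: measurable_funM.
  - by apply: measurable_funM => //; exact: measurable_sqrt.
  - by move=> x; apply: avg_ge0 => e; exact: nrm_ge0.
  - move=> x.
    have := avg_nrm_chaos_le d0 (a := fun m i j => f m (tnth x i) (tnth x j)) (Z0 x).
    move=> ch; apply: (@le_trans _ _ (4 * (64 * L * Num.sqrt (Z x)))); last by lra.
    apply: le_trans (ler_wpM2l (ler0n _ 4) (ch _)); last first.
      by move=> m; apply: le_trans (le_nrm _ m); exact: ler_norm.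
    rewrite -avgZ; apply: le_avg => e.
    rewrite -[X in X * _](ger0_norm (ler0n R 4)) -nrmZ; apply: le_nrm2 => m.
    rewrite le_eqVlt; apply/orP; left; apply/eqP; congr `|_|.
    rewrite mulr_sumr; apply: eq_bigr => i _; rewrite mulr_sumr; apply: eq_bigr => j _.
    by rewrite g0 th0 !mulr0 !addr0.
rewrite EFinM; apply: ExZ_le.
- exact: measurable_sqrt.
- by move=> x; exact: sqrtr_ge0.
- by nonneg.
- by apply: Ex_sqrt_le => //; exact: square_maximal.
Qed.

End CanonicalKernel.

(** Here l = log d, L = log (2 d), t is the fourth root of log d / n and beta = b^(1/2). The roots
    are bounded by comparing squares, with coefficients rounded up to integers. *)
Lemma maximal_numeric_bound (R : realType) (N l L t beta D2 D4 M4 : R) :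
  4 <= N -> 0 <= l -> 0 <= L <= 2 * l -> 0 <= t -> l = N * t ^+ 4 -> t ^+ 2 <= beta ->
  0 <= D2 -> 0 <= D4 -> 0 <= M4 ->
  (N * (N - 1))^-1 * (256 * L * Num.sqrt (2 * N ^+ 2 * D2 ^+ 2 +
     8 * N * Num.sqrt (16 * L * (2 * (N * D4 ^+ 4) + 128 * L * M4 ^+ 4)) +
     (256 * L) ^+ 2 * Num.sqrt (M4 ^+ 4))) <=
  1024 * 512 * (1 + beta) * (t ^+ 6 * M4 + t ^+ 4 * D2 + t ^+ 5 * D4).
Proof.
move=> N4 l0 /andP[L0 Ll] t0 lt tb D20 D40 M40.
have N0 : 0 < N by lra.
have t4 : 0 <= t ^+ 4 by exact: exprn_ge0.
(* With L <= 2 l the radicand is at most N^2 (64 t^4 D4^4 + 8192 t^8 M4^4); 8^2 = 64 and 91^2 >=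
   8192. *)
have s1 : Num.sqrt (16 * L * (2 * (N * D4 ^+ 4) + 128 * L * M4 ^+ 4)) <=
    N * (8 * t ^+ 2 * D4 ^+ 2 + 91 * t ^+ 4 * M4 ^+ 2).
  have r0 : 0 <= N * (8 * t ^+ 2 * D4 ^+ 2 + 91 * t ^+ 4 * M4 ^+ 2).
    by have := ltW N0 => ?; nonneg.
  rewrite -[leRHS](ger0_norm r0) -sqrtr_sqr ler_wsqrtr//.
  apply: (@le_trans _ _ (16 * (2 * l) * (2 * (N * D4 ^+ 4) + 128 * (2 * l) * M4 ^+ 4))).
    have N0' := ltW N0; apply: ler_pM.
    - nonneg.
    - nonneg.
    - by apply: ler_wpM2l => //; nonneg.
    - rewrite lerD2l; apply: ler_wpM2r; first by nonneg.
      by apply: ler_wpM2l => //; nonneg.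
  rewrite lt -subr_ge0 (_ : _ - _ = N ^+ 2 * (89 * t ^+ 8 * M4 ^+ 4 +
    1456 * t ^+ 6 * D4 ^+ 2 * M4 ^+ 2)); last by ring.
  by have N0' := ltW N0; nonneg.
have s2 : Num.sqrt (M4 ^+ 4) = M4 ^+ 2.
  by rewrite (exprM _ 2 2) sqrtr_sqr ger0_norm// sqr_ge0.
(* Roots of 2 (rounded up), 8 * 8 = 64, 8 * 91 = 728 <= 27^2 and (256 * 2)^2. *)
set X := 2 * D2 + 8 * t * D4 + (27 * t ^+ 2 + 512 * t ^+ 4) * M4.
have X0 : 0 <= X by rewrite /X; nonneg.
have s3 : Num.sqrt (2 * N ^+ 2 * D2 ^+ 2 +
     8 * N * Num.sqrt (16 * L * (2 * (N * D4 ^+ 4) + 128 * L * M4 ^+ 4)) +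
     (256 * L) ^+ 2 * Num.sqrt (M4 ^+ 4)) <= N * X.
  have NX0 : 0 <= N * X by rewrite mulr_ge0// ltW.
  rewrite -[leRHS](ger0_norm NX0) -sqrtr_sqr ler_wsqrtr// s2.
  apply: (@le_trans _ _ (2 * N ^+ 2 * D2 ^+ 2 +
      8 * N * (N * (8 * t ^+ 2 * D4 ^+ 2 + 91 * t ^+ 4 * M4 ^+ 2)) +
     (256 * (2 * l)) ^+ 2 * M4 ^+ 2)).
    apply: lerD.
      by rewrite lerD2l; apply: ler_wpM2l => //; have N0' := ltW N0; nonneg.
    apply: ler_wpM2r; first by nonneg.
    rewrite ler_pXn2r ?nnegrE; [|by []|by nonneg|by nonneg].
    by apply: ler_wpM2l; [nonneg|].
  rewrite lt -subr_ge0 (_ : _ - _ = N ^+ 2 * (2 * D2 ^+ 2 + t ^+ 4 * M4 ^+ 2 +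
    27 * 1024 * t ^+ 6 * M4 ^+ 2 + 32 * t * D2 * D4 +
    4 * D2 * ((27 * t ^+ 2 + 512 * t ^+ 4) * M4) +
    16 * t * D4 * ((27 * t ^+ 2 + 512 * t ^+ 4) * M4))); last by rewrite /X; ring.
  by have N0' := ltW N0; nonneg.
have NN : (N * (N - 1))^-1 <= 2 / N ^+ 2.
  rewrite -[leRHS]invrK invf_div lef_pV2 ?posrE; [nra| |]; last by rewrite divr_gt0 ?exprn_gt0.
  by rewrite mulr_gt0//; lra.
apply: (@le_trans _ _ (2 / N ^+ 2 * (256 * (2 * l) * (N * X)))).
  have X1 : 0 <= 256 * L by nonneg.
  have X2 : 256 * L <= 256 * (2 * l) by apply: ler_wpM2l; [nonneg|].
  move: (256 * L) (256 * (2 * l)) s3 X1 X2 => u v s3 X1 X2.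
  apply: ler_pM => //.
  - by rewrite invr_ge0 mulr_ge0 ?(ltW N0)//; lra.
  - by nonneg.
  - by apply: ler_pM => //; nonneg.
rewrite (_ : 2 / N ^+ 2 * _ = 1024 * t ^+ 4 * X); last by rewrite lt; field; lra.
rewrite -[leLHS]mulrA (_ : 1024 * 512 * _ * _ =
  1024 * (512 * (1 + beta) * (t ^+ 6 * M4 + t ^+ 4 * D2 + t ^+ 5 * D4))); last by ring.
apply: ler_wpM2l; first by nonneg.
have b0 : 0 <= beta by apply: le_trans tb; exact: exprn_ge0.
(* The only term out of scale. Its coefficient 512 is the largest and becomes the common one. *)
have h1 : t ^+ 8 * M4 <= beta * (t ^+ 6 * M4).
  rewrite (_ : t ^+ 8 * M4 = t ^+ 2 * (t ^+ 6 * M4)); last by ring.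
  by rewrite ler_wpM2r// mulr_ge0 ?exprn_ge0.
have p1 : 0 <= t ^+ 6 * M4 by rewrite mulr_ge0 ?exprn_ge0.
have p2 : 0 <= t ^+ 4 * D2 by rewrite mulr_ge0 ?exprn_ge0.
have p3 : 0 <= t ^+ 5 * D4 by rewrite mulr_ge0 ?exprn_ge0.
rewrite (_ : t ^+ 4 * X = 2 * (t ^+ 4 * D2) + 8 * (t ^+ 5 * D4) + 27 * (t ^+ 6 * M4) +
  512 * (t ^+ 8 * M4)); last by rewrite /X; ring.
nra.
Qed.

Lemma maximal_numeric (R : realType) : exists K : R, 0 < K /\
  forall N l L t beta D2 D4 M4 : R,
  4 <= N -> 0 <= l -> 0 <= L <= 2 * l -> 0 <= t -> l = N * t ^+ 4 -> t ^+ 2 <= beta ->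
  0 <= D2 -> 0 <= D4 -> 0 <= M4 ->
  (N * (N - 1))^-1 * (256 * L * Num.sqrt (2 * N ^+ 2 * D2 ^+ 2 +
     8 * N * Num.sqrt (16 * L * (2 * (N * D4 ^+ 4) + 128 * L * M4 ^+ 4)) +
     (256 * L) ^+ 2 * Num.sqrt (M4 ^+ 4))) <=
  K * (1 + beta) * (t ^+ 6 * M4 + t ^+ 4 * D2 + t ^+ 5 * D4).
Proof.
exists (1024 * 512); split; first by apply: mulr_gt0; exact: ltr0Sn.
by move=> N l L t beta D2 D4 M4; exact: maximal_numeric_bound.
Qed.

(** * Moments, integrability and the theorem *)

Lemma norm_row (R : realType) (d : nat) (v : 'rV[R]_d) : `|v| = nrm (v ord0).
Proof.
rewrite [LHS]mx_normrE; apply/le_anti/andP; split.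
  apply: bigmax_le => [|[i j] _]; first exact: nrm_ge0.
  by rewrite ord1; exact: le_nrm.
apply: nrm_le => [|m]; first exact: bigmax_ge_id.
exact: (le_bigmax _ (fun ij => `|v ij.1 ij.2|) (ord0, m)).
Qed.

Section Moments.
Context (R : realType) (dT : measure_display) (T : measurableType dT)
  (mu : {measure set T -> \bar R}).

Lemma integral_pow_le_Lnorm (k : nat) (u : T -> R) (D : R) : (0 < k)%N -> 0 <= D ->
  ('N[mu]_(k%:R%:E)[EFin \o u] <= D%:E)%E ->
  (\int[mu]_x (`|u x| ^+ k)%:E <= (D ^+ k)%:E)%E.
Proof.
move=> k0 D0 uD; have k_neq0 : k%:R != 0 :> R by rewrite pnatr_eq0 -lt0n.
have -> : (\int[mu]_x (`|u x| ^+ k)%:E = 'N[mu]_(k%:R%:E)[EFin \o u] `^ k%:R)%E.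
  rewrite poweR_Lnorm//; apply: eq_integral => x _ /=.
  by rewrite powR_mulrn.
rewrite -powR_mulrn// -poweR_EFin.
apply: gt0_ler_poweR => //; rewrite in_itv /= leey andbT; first exact: Lnorm_ge0.
by rewrite lee_fin.
Qed.

(** An infinite positive or negative part makes the extended-real difference infinite, oo - oo being
    -oo. This is how canonicity yields integrability. *)
Lemma fin_num_integrable (u : T -> R) : measurable_fun setT u ->
  (\int[mu]_x (u x)%:E)%E \is a fin_num -> mu.-integrable setT (EFin \o u).
Proof.
move=> mu_; have mEu : measurable_fun setT (EFin \o u) by exact/measurable_EFinP.
rewrite integralE => fin; apply/integrableP; split => //.
rewrite (_ : (\int[mu]_x _)%E = (\int[mu]_x ((EFin \o u)^\+ x + (EFin \o u)^\- x))%E); last first.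
  by apply: eq_integral => x _; rewrite -/((abse \o (EFin \o u)) x) fune_abse.
rewrite ge0_integralD//; last 2 first.
- exact: measurable_funepos.
- exact: measurable_funeneg.
have p0 : (0 <= \int[mu]_x (EFin \o u)^\+ x)%E by exact: integral_ge0.
have q0 : (0 <= \int[mu]_x (EFin \o u)^\- x)%E by exact: integral_ge0.
move: fin p0 q0; set p := (\int[mu]_x (EFin \o u)^\+ x)%E.
set q := (\int[mu]_x (EFin \o u)^\- x)%E.
by move: p q => [p| |] [q| |] //= _ _ _; rewrite -EFinD ltry.
Qed.

End Moments.

(* On row vectors [`| v |] is the library's sup norm max_j |v_j|. *)
Theorem theorem5p1 (R : realType) :
  exists K : R, 0 < K /\
  forall (dW : measure_display) (W : measurableType dW) (P : probability W R)
    (dS : measure_display) (S : measurableType dS)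
    (n : nat) (n4 : (4 <= n)%N) (X : 'I_n -> {RV P >-> S})
    (d : nat) (f : S -> S -> 'rV[R]_d) (b : R),
  let X1 := X (first_index n4) in
  let X2 := X (second_index n4) in
  let r : R := ln d%:R / n%:R in
  separable_measurable S ->
  iid X ->
  kernel_measurable f ->
  kernel_symmetric f ->
  kernel_canonical X1 X2 f ->
  (forall m : 'I_d, 'E_P[fun w => `|f (X1 w) (X2 w) ord0 m|%R] < +oo)%E ->
  0 < b ->
  (2 <= d)%N ->
  d%:R <= expR (b * n%:R) ->
  ('E_P[fun w => `|Vn X f w|%R] <=
    (K * (1 + b `^ (1 / 2)))%:E *
    ((r `^ (3 / 2))%:E * 'N[P]_(4%:E)[EFin \o Mn X f]
     + r%:E * Dq X1 X2 f 2
     + (r `^ (5 / 4))%:E * Dq X1 X2 f 4))%E.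
Proof.
have [K [K_gt0 numeric]] := maximal_numeric R.
exists K; split => //.
move=> dW W P dS S n n4 X d f b X1 X2 r _ [indepX idX] mf fsym fcan _ b0 d2 db.
pose mu : probability S R := distribution P X1.
have lawX i A : measurable A -> P (X i @^-1` A) = mu A by move=> mA; exact: (idX i).
set i0 := first_index n4 in X1 mu lawX fcan *.
set i1 := second_index n4 in X2 fcan *.
have i01 : i0 != i1 by [].
pose fm m x y := f x y ord0 m.
have fmsym m x y : fm m x y = fm m y x by rewrite /fm fsym.
have d0 : (0 < d)%N by exact: ltnW.
pose M (x : n.-tuple S) := \big[Num.max/0]_(i < n) \big[Num.max/0]_(j < n | i != j)
    \big[Num.max/0]_(m < d) `|fm m (tnth x i) (tnth x j)|.
have mM : measurable_fun [set: n.-tuple S] M.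
  do 3 apply: measurable_bigmax => ?; apply: measurableT_comp => //.
  exact: measurable_pair.
have fM x i j m : i != j -> `|fm m (tnth x i) (tnth x j)| <= M x.
  move=> ij; apply: (bigmax_sup i) => //; apply: (bigmax_sup j) => //.
  exact: (bigmax_sup m).
have ME : Mn X f = M \o sample X.
  apply/funext => w; apply: eq_bigr => i _; apply: eq_bigr => j _; apply: eq_bigr => m _.
  by rewrite !tnth_mktuple.
(* [mu] is the law of [X1], so the condition on f(X1, x) is the one transferred, after exchanging
   the arguments by symmetry. *)
have fcan' m x : mu.-integrable setT (EFin \o fm m x) /\ \int[mu]_y fm m x y = 0.
  have [_ /(_ x) E0 _] := fcan m; rewrite unlock in E0.
  have mfx : measurable_fun setT (fm m x).
    apply: (measurableT_comp (f := fun z : S * S => fm m z.1 z.2) (g := fun y => (x, y))).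
      exact: mf.
    by apply: measurable_fun_pair; [exact: measurable_cst|exact: measurable_id].
  have E1 : (\int[P]_w (fm m x (X1 w))%:E = 0)%E.
    by rewrite -[RHS]E0; apply: eq_integral => w _; rewrite fmsym.
  have If : P.-integrable setT (EFin \o (fm m x \o X1)).
    apply: fin_num_integrable; first exact: measurableT_comp.
    by rewrite /= E1.
  split.
    have mEf : measurable_fun setT (EFin \o fm m x) by exact/measurable_EFinP.
    apply/integrableP; split => //; have /integrableP[_] := If.
    have mA : measurable_fun setT (abse \o (EFin \o fm m x)) by exact: measurableT_comp.
    by rewrite (ge0_integral_distribution X1 mA)// => y; exact: abse_ge0.
  by rewrite /Rintegral integral_distribution//= ?E1//; exact/measurable_EFinP.
have n_gt0 : 0 < n%:R :> R by rewrite ltr0n; exact: (leq_trans _ n4).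
have l0 : 0 < ln d%:R :> R by rewrite ln_gt0// ltr1n.
have r0 : 0 < r by rewrite divr_gt0.
have rb : r <= b.
  by rewrite /r ler_pdivrMr// -[leRHS]expRK ler_ln// ?posrE ?expR_gt0// ltr0n.
have VnE : ('E_P[fun w => `|Vn X f w|%R] = ((n%:R * (n%:R - 1))^-1)%:E *
    mean X (fun x => nrm (fun m => \sum_i \sum_(j | i != j) fm m (tnth x i) (tnth x j)))%R)%E.
  rewrite unlock -ExZ; last 3 first.
  - apply: measurable_nrm => m; apply: measurable_sum => i.
    under eq_fun do rewrite big_mkcond; apply: measurable_sum => j.
    by case: (i != j) => //; exact: measurable_pair.
  - by move=> w; exact: nrm_ge0.
  - by rewrite invr_ge0 mulr_ge0// subr_ge0 ler1n; exact: (leq_trans _ n4).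
  apply: eq_integral => w _; congr EFin; rewrite /Vn normrZ norm_row ger0_norm; last first.
    by rewrite invr_ge0 mulr_ge0// subr_ge0 ler1n; exact: (leq_trans _ n4).
  congr (_ * nrm _); apply/funext => m; rewrite summxE; apply: eq_bigr => i _.
  by rewrite summxE; apply: eq_bigr => j _; rewrite !tnth_mktuple.
rewrite {}VnE.
set N4 := ('N[P]_(4%:E)[EFin \o Mn X f])%E.
set e2 := Dq X1 X2 f 2; set e4 := Dq X1 X2 f 4.
have N4_ge0 : (0 <= N4)%E by exact: Lnorm_ge0.
have Dq_ge0 q : (0 <= Dq X1 X2 f q)%E by exact: bigmax_ge_id.
have e2_ge0 : (0 <= e2)%E by exact: Dq_ge0.
have e4_ge0 : (0 <= e4)%E by exact: Dq_ge0.
have K0 : 0 < K * (1 + b `^ (1 / 2)).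
  by rewrite mulr_gt0// ltr_wpDr ?powR_ge0.
have r32 : 0 < r `^ (3 / 2) by exact: powR_gt0.
have r54 : 0 < r `^ (5 / 4) by exact: powR_gt0.
have LnormDq m q : ('N[P]_(q%:E)[EFin \o (fun w => fm m (X1 w) (X2 w))] <= Dq X1 X2 f q)%E.
  exact: (le_bigmax _ (fun m => 'N[P]_(q%:E)[EFin \o (fun w => fm m (X1 w) (X2 w))])%E).
have term_ge0 q (e : \bar R) : 0 < q -> (0 <= e)%E -> (q%:E * e != -oo)%E.
  by move=> q0 e0_; rewrite gt_eqF// (lt_le_trans ltNy0)// mule_ge0// lee_fin ltW.
(* An infinite moment makes the right-hand side infinite, every coefficient being positive: r > 0
   because d >= 2. *)
have [N4_oo|N4_fin] := eqVneq N4 +oo%E.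
  rewrite N4_oo gt0_muley ?lte_fin// addye ?term_ge0// addye ?term_ge0//.
  by rewrite gt0_muley ?lte_fin// leey.
have [e2_oo|e2_fin] := eqVneq e2 +oo%E.
  rewrite e2_oo [(r%:E * _)%E]gt0_muley ?lte_fin// addey ?term_ge0// addye ?term_ge0//.
  by rewrite gt0_muley ?lte_fin// leey.
have [e4_oo|e4_fin] := eqVneq e4 +oo%E.
  rewrite e4_oo [(_ * +oo)%E]gt0_muley ?lte_fin// addey; last first.
    by rewrite gt_eqF// (lt_le_trans ltNy0)// adde_ge0// mule_ge0// lee_fin ltW.
  by rewrite gt0_muley ?lte_fin// leey.
have toR (e : \bar R) : (0 <= e)%E -> e != +oo%E -> exists2 D : R, 0 <= D & e = D%:E.
  by case: e => [D| |]// D0 _; exists D; rewrite -?lee_fin.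
have [M4 M4_ge0 N4E] := toR _ N4_ge0 N4_fin.
have [D2 D2_ge0 e2E] := toR _ e2_ge0 e2_fin.
have [D4 D4_ge0 e4E] := toR _ e4_ge0 e4_fin.
have pairE m (k : nat) :
    mean X (fun x => `|fm m (tnth x i0) (tnth x i1)| ^+ k) =
    (\int[P]_w (`|fm m (X1 w) (X2 w)| ^+ k)%:E)%E.
  by apply: eq_integral => w _; rewrite !tnth_mktuple.
have D2_bound m : (mean X (fun x => fm m (tnth x i0) (tnth x i1) ^+ 2)%R <= (D2 ^+ 2)%:E)%E.
  have := LnormDq m 2; rewrite -/e2 e2E.
  move=> /(integral_pow_le_Lnorm (k := 2) isT D2_ge0); rewrite -pairE; apply: le_trans.
  by rewrite le_eqVlt; apply/orP; left; apply/eqP; congr (mean X); apply/funext => x;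
    rewrite real_normK ?num_real.
have D4_bound m : (mean X (fun x => fm m (tnth x i0) (tnth x i1) ^+ 4)%R <= (D4 ^+ 4)%:E)%E.
  have := LnormDq m 4; rewrite -/e4 e4E.
  move=> /(integral_pow_le_Lnorm (k := 4) isT D4_ge0); rewrite -pairE; apply: le_trans.
  rewrite le_eqVlt; apply/orP; left; apply/eqP; congr (mean X); apply/funext => x.
  by rewrite !(exprM _ 2 2) real_normK ?num_real.
have M4_bound : (mean X (fun x => M x ^+ 4)%R <= (M4 ^+ 4)%:E)%E.
  have : (N4 <= M4%:E)%E by rewrite N4E.
  move=> /(integral_pow_le_Lnorm (k := 4) isT M4_ge0); apply: le_trans.
  rewrite le_eqVlt; apply/orP; left; apply/eqP; apply: eq_integral => w _.
  by rewrite ME /= !(exprM _ 2 2) real_normK ?num_real.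
have := canonical_kernel_maximal indepX lawX d0 fmsym mf i01 mM fM
  (exprn_ge0 2 D2_ge0) (exprn_ge0 4 D4_ge0) (exprn_ge0 4 M4_ge0)
  D2_bound D4_bound M4_bound fcan'.
set EV := mean X _ => EV_le.
rewrite [leRHS](_ : _ = (K * (1 + b `^ (1 / 2)) *
    (r `^ (3 / 2) * M4 + r * D2 + r `^ (5 / 4) * D4))%:E); last first.
  by rewrite N4E e2E e4E [RHS]EFinM !EFinD ![(_ * _ : R)%:E]EFinM.
apply: (@le_trans _ _ (((n%:R * (n%:R - 1))^-1)%:E * _)%E).
  apply: lee_wpmul2l EV_le.
  by rewrite lee_fin invr_ge0 mulr_ge0// subr_ge0 ler1n; exact: (leq_trans _ n4).
rewrite -EFinM lee_fin.
(* With the fourth root, the exponents 3/2, 1 and 5/4 become the integers 6, 4 and 5, and the final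
   inequality is polynomial apart from the square roots. *)
pose t := r `^ 4^-1.
have tX k : t ^+ k = r `^ (4^-1 * k%:R).
  by rewrite -powR_mulrn ?powR_ge0// -powRrM.
have t4 : t ^+ 4 = r by rewrite tX mulVf ?pnatr_eq0// powRr1// ltW.
have -> : r `^ (3 / 2) = t ^+ 6 by rewrite tX; congr (_ `^ _); field.
have -> : r `^ (5 / 4) = t ^+ 5 by rewrite tX; congr (_ `^ _); field.
rewrite -[X in X * D2]t4.
apply: (numeric _ (ln d%:R)) => //.
- by rewrite ler_nat.
- exact: ltW.
- rewrite ltW ?ln2d_gt0//= lnM ?posrE ?ltr0n//.
  have l2 : ln 2 <= ln d%:R :> R by rewrite ler_ln ?posrE ?ltr0n// (ler_nat R 2).
  lra.
- exact: powR_ge0.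
- by rewrite t4 /r mulrC divfK// gt_eqF.
- rewrite tX (_ : 4^-1 * 2 = 1 / 2); last by field.
  by apply: ge0_ler_powR; rewrite ?nnegrE// ?ltW// divr_gt0.
Qed.
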